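(* If $E_1,\dots,E_s$ are $\mathcal{L}_\infty$-spaces then, for any Banach spaces $E_{s+1},\dots,E_n$, $$\mathcal{L}(E_1,\dots,E_n;\mathbb{K})=\mathcal{L}_{as(1;q_1,\dots,q_n)}(E_1,\dots,E_n;\mathbb{K}),$$ where $q_1=\dots=q_s=2$ and $q_{s+1}=\dots=q_n=1$.
   Context: All Banach spaces are over the scalar field $\mathbb{K}$, which is $\mathbb{R}$ or $\mathbb{C}$. $\mathcal{L}(E_1,\dots,E_n;F)$ is the space of bounded $n$-linear mappings $E_1\times\dots\times E_n\to F$. For $p\ge1$, $l_p(E)$ is the space of sequences $(x_j)$ in $E$ with $\sum_j\|x_j\|^p<\infty$, and $l_p^w(E)$ is the space of sequences $(x_j)$ in $E$ with $(\varphi(x_j))_j\in l_p$ for every bounded linear functional $\varphi$ on $E$. A mapping $T\in\mathcal{L}(E_1,\dots,E_n;F)$ is absolutely $(p;q_1,\dots,q_n)$-summing if $(T(x_j^{(1)},\dots,x_j^{(n)}))_{j=1}^\infty\in l_p(F)$ whenever $(x_j^{(i)})_{j=1}^\infty\in l_{q_i}^w(E_i)$ for $i=1,\dots,n$; the space of all such mappings is denoted $\mathcal{L}_{as(p;q_1,\dots,q_n)}(E_1,\dots,E_n;F)$. A Banach space $E$ is an $\mathcal{L}_\infty$-space (Lindenstrauss–Pełczyński) if there is $\lambda\ge1$ such that every finite-dimensional subspace of $E$ is contained in a finite-dimensional subspace $G\subseteq E$ whose Banach–Mazur distance to $l_\infty^{\dim G}$ is at most $\lambda$.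
   Formalization: The formal theorem assumes n ≥ 2 (with 1 ≤ s ≤ n); the excluded case n = s = 1 is false: for E_1 = K, T the identity and x_j = 1/j, the sequence is weakly 2-summable but (T(x_j)) is not in l_1. *)

(* Defs.v *)
From HB Require Import structures.
From mathcomp Require Import all_boot all_order all_algebra.
From mathcomp Require Import complex.
From mathcomp Require Import all_classical all_reals all_analysis.

Set Implicit Arguments.
Unset Strict Implicit.
Unset Printing Implicit Defensive.

Import Order.TTheory GRing.Theory Num.Theory.
Import numFieldNormedType.Exports.

Local Open Scope classical_set_scope.
Local Open Scope ring_scope.

Variant scalars := RealScalars | ComplexScalars.

Definition scalar_field (R : realType) (k : scalars) : numFieldType :=
  match k with
  | RealScalars => R
  | ComplexScalars => R[i]
  end.

(* MathComp norms take their values in the scalar field itself; [rnorm] is the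
   norm as an element of [R]. *)
Definition re_scalar (R : realType) (k : scalars) : scalar_field R k -> R :=
  match k return scalar_field R k -> R with
  | RealScalars => fun z => z
  | ComplexScalars => fun z => complex.Re z
  end.

Section Definitions.
Context {R : realType} {k : scalars}.
Local Notation K := (scalar_field R k).

Definition rnorm (V : normedModType K) (x : V) : R := re_scalar `|x|.

Definition lp (V : normedModType K) (p : R) : set (nat -> V) :=
  [set x | (\sum_(0 <= j <oo) (rnorm (x j) `^ p)%:E < +oo)%E].

Definition bounded_functional (V : normedModType K) (phi : {linear V -> K^o}) :=
  exists C : K, forall x, `|phi x| <= C * `|x|.

Definition lpw (V : normedModType K) (p : R) : set (nat -> V) :=
  [set x | forall phi : {linear V -> K^o},
     bounded_functional phi -> lp p (fun j => phi (x j))].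

Section Multilinear.
Context {n : nat} (E : 'I_n -> normedModType K) (F : normedModType K).

Definition multilinear_map (T : (forall i, E i) -> F) :=
  forall (x : forall i, E i) (i : 'I_n) (a : K) (u v : E i),
    T (dfwith x i (a *: u + v)) = a *: T (dfwith x i u) + T (dfwith x i v).

Definition bounded_multilinear : set ((forall i, E i) -> F) :=
  [set T | multilinear_map T /\
     exists C : K, forall x, `|T x| <= C * \prod_i `|x i|].

Definition abs_summing (p : R) (q : 'I_n -> R) : set ((forall i, E i) -> F) :=
  [set T | bounded_multilinear T /\
     forall x : forall i, nat -> E i,
       (forall i, lpw (q i) (x i)) -> lp p (fun j => T (fun i => x i j))].

End Multilinear.

Section LInfinity.
Context {V : normedModType K}.

Definition spanned_by m (e : 'I_m -> V) : set V :=
  [set \sum_i a i *: e i | a in [set: 'I_m -> K]].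

Definition lin_indep m (e : 'I_m -> V) :=
  forall a : 'I_m -> K, \sum_i a i *: e i = 0 -> forall i, a i = 0.

Definition subspace_of_dim (G : set V) (m : nat) :=
  exists e : 'I_m -> V, lin_indep e /\ G = spanned_by e.

Definition isomorphism_onto (W : normedModType K) (G : set V)
    (u : {linear W -> V}) :=
  injective u /\ range u = G.

Definition op_norm (W : normedModType K) (u : {linear W -> V}) : \bar R :=
  ereal_sup [set (rnorm (u y))%:E | y in [set y | `|y| <= 1]].

(* For [u] injective, this is the norm of the inverse of [u], defined on the
   range of [u]. *)
Definition inv_op_norm (W : normedModType K) (u : {linear W -> V}) : \bar R :=
  ereal_sup [set (rnorm y)%:E | y in [set y | `|u y| <= 1]].

Definition banach_mazur (W : normedModType K) (G : set V) : \bar R :=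
  ereal_inf [set (op_norm u * inv_op_norm u)%E
            | u in [set u : {linear W -> V} | isomorphism_onto G u]].

(* The norm on row vectors is the sup norm, so ['rV[K]_m] is $l_\infty^m$. *)
Definition Linfty_space :=
  exists lambda : R, 1 <= lambda /\
    forall (F : set V) (m : nat), subspace_of_dim F m ->
      exists (G : set V) (d : nat),
        [/\ subspace_of_dim G d, F `<=` G &
            (banach_mazur 'rV[K]_d G <= lambda%:E)%E].

End LInfinity.
End Definitions.

Arguments Linfty_space {R k} V.
Arguments bounded_multilinear {R k n} E F.
Arguments abs_summing {R k n} E F p q.

(* Main.v *)
From HB Require Import structures.
Require Import Defs.
From mathcomp Require Import all_boot all_order all_algebra.
From mathcomp Require Import complex.
From mathcomp Require Import all_classical all_reals all_analysis.
From mathcomp Require Import ring lra.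
Import Order.TTheory GRing.Theory Num.Theory.
Import numFieldNormedType.Exports.
Set Implicit Arguments.
Unset Strict Implicit.
Unset Printing Implicit Defensive.
Local Open Scope classical_set_scope.
Local Open Scope ring_scope.

(** The inclusion to prove is that of bounded multilinear forms in summing ones.
    It rests on a multilinear form of Grothendieck's inequality: there is a
    constant, depending only on the number [n >= 2] of variables, that bounds
    the modulus of [\sum_j T(x_j^1, ..., x_j^n)] for every [n]-linear form [T]
    of norm at most 1 on finite-dimensional sup-norm spaces and all finite
    families with [\sum_j |x_j^i(t)|^2 <= 1] at every coordinate [t]
    ([grothendieck]).

    Every variable of the theorem reduces to such spaces
    ([linf_factorable]). The first [N] terms of a weakly 1-summable sequence are
    the images of the unit vectors of [l_infty^N] under a bounded map
    ([lpw1_factorable]). Those of a weakly 2-summable sequence in an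
    [L_infty]-space lie in a subspace uniformly isomorphic to some [l_infty^d],
    in which weak 2-summability becomes the coordinatewise condition above
    ([Linfty_lpw2_factorable]). Both facts need the Hahn-Banach theorem, for a
    norming functional and for extending coordinate functionals
    ([hahn_banach]), and a uniform bound for the weak sums over the dual unit
    ball, obtained by a gliding hump ([weakly_summable_bounded]). A phase put in
    one variable turns the modulus of the sum into the sum of the moduli
    ([factorable_summing]).

    Grothendieck's inequality is proved by truncation. A family in one variable
    is the family of Rademacher coefficients of its Rademacher sum [X]. By the
    fourth-moment bound [E |X|^4 <= 3], cutting [X] at height 2 leaves an error
    of [L2] norm at most [1 / 4] at each coordinate, and by Bessel's inequality
    the coefficients of the error form an [l2] family of the same size
    ([slot_split]). If [G] is the best constant, the error contributes at most
    [G / 4]. With two variables, truncating both leaves a main term of modulus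
    at most 4 and errors of at most [G / 2] in total ([bilinear_step]). With
    more variables, the truncated variable is bounded and can be frozen, which
    reduces the number of variables by one ([summing_bound_step]). Since [G] is
    finite ([summing_bound_exists]) these inequalities can be solved for it. *)

(** * Real and complex scalars *)

Section Scalars.
Context {R : realType} {k : scalars}.
Local Notation K := (scalar_field R k).

(** Norms take values in the scalar field; the embedding of the reals lets every
    estimate be carried out in [R], through [rnorm]. *)
Definition of_real : R -> K :=
  match k return R -> scalar_field R k with
  | RealScalars => fun r => r
  | ComplexScalars => fun r => r%:C%C
  end.

Lemma of_real_is_additive : {morph of_real : x y / x - y}.
Proof. by rewrite /of_real; case: k => //= x y; rewrite rmorphB. Qed.

Lemma of_real_is_monoid_morphism : GRing.monoid_morphism of_real.
Proof.
by rewrite /of_real; case: k; split=> //= x y; rewrite rmorphM.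
Qed.

HB.instance Definition _ :=
  GRing.isZmodMorphism.Build R K of_real of_real_is_additive.
HB.instance Definition _ :=
  GRing.isMonoidMorphism.Build R K of_real of_real_is_monoid_morphism.

Lemma re_scalar_is_additive : {morph (@re_scalar R k) : x y / x - y}.
Proof. by rewrite /re_scalar; case: k => //= x y; rewrite raddfB. Qed.

HB.instance Definition _ :=
  GRing.isZmodMorphism.Build K R (@re_scalar R k) re_scalar_is_additive.

Lemma of_realK : cancel of_real (@re_scalar R k).
Proof. by rewrite /of_real /re_scalar; case: k. Qed.

Lemma re_scalarK (z : K) : 0 <= z -> of_real (re_scalar z) = z.
Proof.
rewrite /of_real /re_scalar; case: k z => //= z z0.
by rewrite RRe_real// ger0_real.
Qed.

Lemma le_of_real (a b : R) : (of_real a <= of_real b) = (a <= b).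
Proof. by rewrite /of_real; case: k => //=; rewrite lecR. Qed.

Lemma re_scalarZ (a : R) (z : K) : re_scalar (of_real a * z) = a * re_scalar z.
Proof.
rewrite /of_real /re_scalar; case: k z => //= -[x y] /=.
by rewrite mul0r subr0.
Qed.

Lemma normE (V : normedModType K) (x : V) : `|x| = of_real (rnorm x).
Proof. by rewrite /rnorm re_scalarK. Qed.

Lemma scalar_rnormE (z : K^o) : rnorm z =
  match k return scalar_field R k -> R with
  | RealScalars => fun z => `|z|
  | ComplexScalars => fun z => Num.sqrt (complex.Re z ^+ 2 + complex.Im z ^+ 2)
  end z.
Proof. by rewrite /rnorm /re_scalar; case: k z => //= -[x y]. Qed.

Lemma rnorm_of_real (a : R) : rnorm (of_real a : K^o) = `|a|.
Proof.
rewrite scalar_rnormE /of_real; case: k => //=.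
by rewrite expr0n/= addr0 sqrtr_sqr.
Qed.

Lemma le_rnormP (V W : normedModType K) (c : R) (x : V) (y : W) :
  (`|x| <= of_real c * `|y|) = (rnorm x <= c * rnorm y).
Proof. by rewrite !normE -rmorphM/= le_of_real. Qed.

Section Rnorm.
Context {V : normedModType K}.
Implicit Types x y : V.

Lemma rnorm_ge0 x : 0 <= rnorm x.
Proof. by rewrite -le_of_real -normE rmorph0. Qed.

Lemma rnorm0 : rnorm (0 : V) = 0.
Proof. by rewrite /rnorm normr0 raddf0. Qed.

Lemma rnorm_eq0 x : rnorm x = 0 -> x = 0.
Proof. by move=> x0; apply/normr0_eq0; rewrite normE x0 rmorph0. Qed.

Lemma rnormN x : rnorm (- x) = rnorm x.
Proof. by rewrite /rnorm normrN. Qed.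

Lemma rnormD x y : rnorm (x + y) <= rnorm x + rnorm y.
Proof. by rewrite -le_of_real rmorphD/= -!normE ler_normD. Qed.

Lemma rnormZ (a : K) x : rnorm (a *: x) = rnorm (a : K^o) * rnorm x.
Proof.
rewrite -[RHS]of_realK rmorphM/= -!normE /rnorm; congr re_scalar.
exact: normrZ.
Qed.

Lemma rnormZr (a : R) x : rnorm (of_real a *: x) = `|a| * rnorm x.
Proof. by rewrite rnormZ rnorm_of_real. Qed.

Lemma rnorm_sum (I : Type) (r : seq I) (P : pred I) (F : I -> V) :
  rnorm (\sum_(i <- r | P i) F i) <= \sum_(i <- r | P i) rnorm (F i).
Proof.
elim/big_rec2: _ => [|i y z _ yz]; first by rewrite rnorm0.
by rewrite (le_trans (rnormD _ _))// lerD2l.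
Qed.

End Rnorm.

Lemma rnormM (a b : K^o) : rnorm (a * b : K^o) = rnorm a * rnorm b.
Proof. exact: rnormZ. Qed.

Lemma re_le_rnorm (z : K^o) : re_scalar z <= rnorm z.
Proof.
rewrite scalar_rnormE /re_scalar; case: k z => /= [z|z]; first exact: ler_norm.
rewrite (le_trans (ler_norm _))// -sqrtr_sqr ler_wsqrtr//.
by rewrite lerDl sqr_ge0.
Qed.

Lemma rnorm1 : rnorm (1 : K^o) = 1.
Proof. by have := rnorm_of_real 1; rewrite rmorph1 normr1. Qed.

Lemma phase (z : K^o) :
  exists w : K, rnorm (w : K^o) = 1 /\ w * z = of_real (rnorm z).
Proof.
have [->|z0] := eqVneq z 0.
  by exists 1; rewrite mulr0 rnorm0 rmorph0 rnorm1.
have nz0 : rnorm z != 0 by apply: contra_neq z0; exact: rnorm_eq0.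
exists (of_real (rnorm z) / z); split; last by rewrite divfK.
apply: (mulIf nz0).
by rewrite -rnormM divfK// mul1r rnorm_of_real ger0_norm// rnorm_ge0.
Qed.

Lemma parallelogram (a b : K^o) :
  rnorm (a + b) ^+ 2 + rnorm (a - b) ^+ 2 = 2 * (rnorm a ^+ 2 + rnorm b ^+ 2).
Proof.
rewrite !scalar_rnormE; case: k a b => /= a b.
  by rewrite !real_normK ?num_real//; ring.
rewrite !sqr_sqrtr ?addr_ge0 ?sqr_ge0//.
by case: a b => [a1 a2] [b1 b2] /=; ring.
Qed.

(** By the parallelogram law the two squared norms are [s + e] and [s - e] with
    [s = |a|^2 + |b|^2], and the triangle inequality gives [|e| <= 2 |a| |b|].
    This is the inductive step of the fourth-moment bound for Rademacher
    sums. *)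
Lemma rnorm4_le (a b : K^o) :
  rnorm (a + b) ^+ 4 + rnorm (a - b) ^+ 4 <=
    2 * (rnorm a ^+ 4 + 6 * (rnorm a ^+ 2 * rnorm b ^+ 2) + rnorm b ^+ 4).
Proof.
have P := parallelogram a b.
have sq_le (u v : K^o) : rnorm (u + v) ^+ 2 <= (rnorm u + rnorm v) ^+ 2.
  by rewrite lerXn2r ?nnegrE ?addr_ge0 ?rnorm_ge0 ?rnormD.
have := sq_le a b; have := sq_le a (- b); rewrite rnormN.
have ab0 : 0 <= rnorm a * rnorm b by rewrite mulr_ge0 ?rnorm_ge0.
rewrite -![_ ^+ 4]/(_ ^+ (2 * 2)) !exprM.
move: P; set p := rnorm (a + b) ^+ 2; set q := rnorm (a - b) ^+ 2.
move: ab0; set A := rnorm a; set B := rnorm b => ab0 P Hq Hp.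
pose e := p - (A ^+ 2 + B ^+ 2).
have pE : p = A ^+ 2 + B ^+ 2 + e by rewrite /e; ring.
have qE : q = A ^+ 2 + B ^+ 2 - e by rewrite /e; lra.
have e2 : e ^+ 2 <= (2 * (A * B)) ^+ 2.
  rewrite -[e ^+ 2]real_normK ?num_real// lerXn2r ?nnegrE//; first by lra.
  by rewrite ler_norml; apply/andP; split; nra.
by rewrite pE qE; nra.
Qed.

End Scalars.

(** * The Hahn-Banach theorem *)

Section HahnBanach.
Context {R : realType} {k : scalars}.
Local Notation K := (scalar_field R k).
Context {V : normedModType K}.

(** Partial real functionals are represented by their graphs, so that the upper
    bound of a chain is simply its union. Domination by [c * rnorm] makes such a
    graph single-valued: if it contains [(x, a)] and [(x, b)], it contains
    [(0, b - a)] and [(0, a - b)], whence [b <= a] and [a <= b]. *)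
Definition dominated_graph (c : R) (G : set (V * R)) :=
  (forall x a y b r, G (x, a) -> G (y, b) ->
     G (of_real r *: x + y, r * a + b)) /\
  (forall x a, G (x, a) -> a <= c * rnorm x).

(** The value [g] at [v] must lie between all [a - c |x - v|] and all
    [c |y + v| - b]; subadditivity of the norm makes every lower bound at most
    every upper bound, and the supremum of the former is taken. Only [t = 1] and
    [t = -1] are thereby controlled: homogeneity gives the other multiples. *)
Lemma dominated_graph_extend (c : R) (G : set (V * R)) (v : V) :
  0 <= c -> dominated_graph c G -> G (0, 0) ->
  exists g : R,
    dominated_graph c [set z | exists x a t,
      G (x, a) /\ z = (x + of_real t *: v, a + t * g)].
Proof.
move=> c0 [Glin Gle] G0.
have Gscale x a r : G (x, a) -> G (of_real r *: x, r * a).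
  by move=> Gxa; have := Glin _ _ _ _ r Gxa G0; rewrite !addr0.
pose L := [set z | exists x a, G (x, a) /\ z = a - c * rnorm (x - v)].
have gap x a y b : G (x, a) -> G (y, b) ->
    a - c * rnorm (x - v) <= c * rnorm (y + v) - b.
  move=> Gx Gy; have := Gle _ _ (Glin _ _ _ _ 1 Gx Gy).
  rewrite rmorph1 scale1r mul1r => ab.
  have : c * rnorm (x + y) <= c * (rnorm (x - v) + rnorm (y + v)).
    rewrite ler_wpM2l// -[x + y](_ : (x - v) + (y + v) = _) ?rnormD//.
    by rewrite addrACA addNr addr0.
  by move: ab; rewrite mulrDr; lra.
have L0 : L !=set0 by exists (0 - c * rnorm (0 - v)), 0, 0.
have Lub : has_sup L.
  split=> //; exists (c * rnorm (0 + v) - 0) => _ [x [a [Gx ->]]].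
  exact: gap Gx G0.
exists (sup L); split=> [x a y b r|x a].
  move=> [x1 [a1 [t1 [Gx1 [-> ->]]]]] [x2 [a2 [t2 [Gx2 [-> ->]]]]].
  exists (of_real r *: x1 + x2), (r * a1 + a2), (r * t1 + t2).
  split; first exact: Glin.
  congr pair; last by ring.
  by rewrite scalerDr rmorphD rmorphM/= scalerDl scalerA addrACA.
move=> [x1 [a1 [t [Gx1 [-> ->]]]]].
have low y b : G (y, b) -> b - c * rnorm (y - v) <= sup L.
  by move=> Gy; apply: ub_le_sup; [case: Lub|exists y, b].
have upp y b : G (y, b) -> sup L <= c * rnorm (y + v) - b.
  by move=> Gy; apply: ge_sup => // _ [z [a2 [Gz ->]]]; exact: gap.
have [t0|t0|->] := ltgtP t 0; last first.
- by rewrite rmorph0 scale0r mul0r !addr0; exact: Gle.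
- have := upp _ _ (Gscale _ _ t^-1 Gx1).
  have <- : t * rnorm (of_real t^-1 *: x1 + v) = rnorm (x1 + of_real t *: v).
    rewrite -{1}(ger0_norm (ltW t0)) -rnormZr scalerDr scalerA -rmorphM/=.
    by rewrite mulfV ?gt_eqF// rmorph1 scale1r.
  rewrite -(ler_pM2l t0) mulrBr mulVKf ?gt_eqF//.
  by rewrite [t * (c * _)]mulrCA; lra.
- have s0 : 0 < - t by lra.
  have := low _ _ (Gscale _ _ (- t)^-1 Gx1).
  have <- : - t * rnorm (of_real (- t)^-1 *: x1 - v) =
            rnorm (x1 + of_real t *: v).
    rewrite -{1}(ger0_norm (ltW s0)) -rnormZr scalerBr scalerA -rmorphM/=.
    by rewrite mulfV ?gt_eqF// rmorph1 scale1r rmorphN scaleNr opprK.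
  rewrite -(ler_pM2l s0) mulrBr mulVKf ?gt_eqF//.
  by rewrite [- t * (c * _)]mulrCA; lra.
Qed.

(** Zorn's lemma is applied to the sets that can be added to [G0], because its
    hypothesis includes the empty chain, whose union has to be admissible
    too. *)
Lemma hahn_banach_real (c : R) (G0 : set (V * R)) :
  0 <= c -> dominated_graph c G0 -> G0 (0, 0) ->
  exists f : V -> R,
    [/\ forall r x y, f (of_real r *: x + y) = r * f x + f y,
        forall x, f x <= c * rnorm x &
        forall x a, G0 (x, a) -> f x = a].
Proof.
move=> c0 domG0 G00.
have [F FP Ftot|A [domA Amax]] :=
    @Zorn_bigcup (V * R)%type (fun A => dominated_graph c (G0 `|` A)).
  have pick z1 z2 : (G0 `|` \bigcup_(X in F) X) z1 ->
      (G0 `|` \bigcup_(X in F) X) z2 ->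
      exists X, [/\ X `<=` \bigcup_(X in F) X, dominated_graph c (G0 `|` X),
        (G0 `|` X) z1 & (G0 `|` X) z2].
    have sub X : F X -> X `<=` \bigcup_(X in F) X by move=> FX z Xz; exists X.
    move=> [z1G|[X1 FX1 Xz1]] [z2G|[X2 FX2 Xz2]].
    - by exists set0; rewrite setU0; split.
    - by exists X2; split; [exact: sub|exact: FP|left|right].
    - by exists X1; split; [exact: sub|exact: FP|right|left].
    - have [X12|X21] := Ftot _ _ FX1 FX2.
        by exists X2; split; [exact: sub|exact: FP|right; exact: X12|right].
      by exists X1; split; [exact: sub|exact: FP|right|right; exact: X21].
  split=> [x a y b r Ux Uy|x a Ux].
    have [X [XF [lin _] X1 X2]] := pick _ _ Ux Uy.
    by have [?|/XF ?] := lin _ _ _ _ r X1 X2; [left|right].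
  by have [X [_ [_ le] X1 _]] := pick _ _ Ux Ux; exact: le.
set G := G0 `|` A in domA.
have G00' : G (0, 0) by left.
have total v : exists a, G (v, a).
  apply: contrapT => nv.
  have [g domg] := dominated_graph_extend v c0 domA G00'.
  set B := [set z | _] in domg.
  have GB : G `<=` B.
    by move=> [x a] Gx; exists x, a, 0; rewrite rmorph0 scale0r mul0r !addr0.
  have Bv : B (v, g).
    by exists 0, 0, 1; rewrite rmorph1 scale1r mul1r !add0r.
  apply: (Amax B).
    split; first by move=> z Az; apply: GB; right.
    by move=> BA; apply: nv; exists g; right; exact: BA.
  rewrite setUidr//.
  by move=> z G0z; apply: GB; left.
have uniqG x a b : G (x, a) -> G (x, b) -> a = b.
  have [lin le] := domA.
  have half a' b' : G (x, a') -> G (x, b') -> b' <= a'.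
    move=> Ga Gb; have := le _ _ (lin _ _ _ _ (-1) Ga Gb).
    by rewrite rmorphN1 scaleN1r addNr rnorm0 mulr0 mulN1r; lra.
  by move=> Ga Gb; apply/eqP; rewrite eq_le !half.
have [f fG] := choice total.
exists f; split.
- by move=> r x y; apply: uniqG (fG _) _; case: domA => lin _; exact: lin.
- by move=> x; case: domA => _ le; exact: le.
- by move=> x a G0x; apply: uniqG (fG _) _; left.
Qed.

(** Taking [i = 0] over the reals lets the formula [f x - i f (i x)] serve both
    scalar fields. *)
Lemma imaginary_unit : exists i : K,
  [/\ i = 0 \/ i * i = -1, forall a, exists r s, a = of_real r + of_real s * i
    & forall r, re_scalar (i * of_real r) = 0].
Proof.
rewrite /of_real /re_scalar; case: k => /=.
  exists 0; split; [by left| |by move=> r; rewrite mul0r].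
  by move=> a; exists a, 0; rewrite mul0r addr0.
exists 'i%C; split; first by right; rewrite -expr2 sqr_i.
  move=> a; exists (complex.Re a), (complex.Im a).
  by rewrite {1}[a]complexE mulrC.
by move=> r; simpc.
Qed.

Lemma complexification (f : V -> R) :
  (forall r x y, f (of_real r *: x + y) = r * f x + f y) ->
  exists phi : {linear V -> K^o}, forall x, re_scalar (phi x) = f x.
Proof.
move=> flin; have [i [i2 span re_i]] := imaginary_unit.
have f0 : f 0 = 0.
  by have := flin (-1) 0 0; rewrite scaler0 add0r mulN1r addNr.
have fD x y : f (x + y) = f x + f y.
  by have := flin 1 x y; rewrite rmorph1 scale1r mul1r.
have fZ r x : f (of_real r *: x) = r * f x.
  by have := flin r x 0; rewrite f0 !addr0.
pose g (x : V) : K^o := of_real (f x) - i * of_real (f (i *: x)).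
have gD x y : g (x + y) = g x + g y.
  by rewrite /g scalerDr !fD !rmorphD/= mulrDr opprD addrACA.
have gZ r x : g (of_real r *: x) = of_real r * g x.
  have iC : i *: (of_real r *: x) = of_real r *: (i *: x).
    by rewrite !scalerA mulrC.
  by rewrite /g iC !fZ !rmorphM/= mulrBr mulrCA.
have gi x : g (i *: x) = i * g x.
  rewrite /g; case: i2 => [->|i2].
    by rewrite !scale0r f0 rmorph0 !mul0r subr0.
  rewrite scalerA i2 -(rmorphN1 (@of_real R k)) fZ !rmorphM rmorphN1/= mulrBr.
  by rewrite (mulrA i i) i2 !mulN1r mulrN !opprK addrC.
have glin : linear g.
  move=> a x y; rewrite gD; congr (_ + _).
  have [r [s ->]] := span a.
  by rewrite scalerDl gD -scalerA !gZ gi -[RHS]/(_ * g x) mulrDl mulrA.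
pose gL := GRing.isLinear.Build K V K^o _ g glin.
pose phi : {linear V -> K^o} := HB.pack g gL.
exists phi => x; rewrite /= /g raddfB/= of_realK re_i subr0//.
Qed.

(** The functional to extend is given on the range of [u] through its pullback
    [g] to [W]; the domination already makes it well defined there. The real
    part is extended first; since a linear functional is determined by its real
    part, the complexified extension agrees with [g], and multiplying by a phase
    turns [|phi x|] into a real part, so the bound carries over. *)
Theorem hahn_banach (W : lmodType K) (u : {linear W -> V})
    (g : {linear W -> K^o}) (c : R) :
  0 <= c -> (forall y, rnorm (g y) <= c * rnorm (u y)) ->
  exists phi : {linear V -> K^o},
    (forall x, rnorm (phi x) <= c * rnorm x) /\ forall y, phi (u y) = g y.
Proof.
move=> c0 gle.
pose G0 := [set z : V * R | exists y, z = (u y, re_scalar (g y : K))].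
have domG0 : dominated_graph c G0.
  split=> [x a y b r [x1 [-> ->]] [x2 [-> ->]]|x a [y [-> ->]]].
    exists (of_real r *: x1 + x2); congr pair; first by rewrite linearP.
    by rewrite linearP raddfD/= -[_ * re_scalar _]re_scalarZ.
  by rewrite (le_trans (re_le_rnorm _)).
have G00 : G0 (0, 0) by exists 0; rewrite !raddf0.
have [f [flin fle fG]] := hahn_banach_real c0 domG0 G00.
have [phi phif] := complexification flin.
exists phi; split=> [x|y].
  have [w [w1 wx]] := phase (phi x).
  have -> : rnorm (phi x) = re_scalar (phi (w *: x)).
    by rewrite linearZ/= [_ *: _]wx of_realK.
  by rewrite phif (le_trans (fle _))// rnormZ w1 mul1r.
apply/eqP; rewrite -subr_eq0; apply/eqP/rnorm_eq0.
have [w [w1 wx]] := phase (phi (u y) - g y).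
apply: (can_inj (@of_realK R k)); rewrite -wx rmorph0.
rewrite -(@re_scalarK R k (w * _)); last by rewrite wx -normE.
rewrite mulrBr -[w * phi _]linearZ -[w * g _]linearZ -linearZ/= raddfB/= phif.
rewrite (fG _ (re_scalar (g (w *: y) : K))) ?subrr ?rmorph0//.
by exists (w *: y).
Qed.
End HahnBanach.

(** * Uniform boundedness of weakly summable sequences *)

Section UniformBoundedness.
Context {R : realType} {k : scalars}.
Local Notation K := (scalar_field R k).

(** [a - e] is nondecreasing, [a + e] is nonincreasing, and every value of the
    first is below every value of the second: the supremum of [a - e] is the
    limit. *)
Lemma real_telescoping_limit (a e : nat -> R) :
  (forall n, 0 <= e n) -> (forall n, `|a n.+1 - a n| <= e n - e n.+1) ->
  exists l, forall n, `|l - a n| <= e n.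
Proof.
move=> e0 ae.
have up n m : (n <= m)%N -> a n - e n <= a m - e m.
  elim: m => [|m IH]; first by rewrite leqn0 => /eqP ->.
  rewrite leq_eqVlt => /predU1P[->//|/IH]; have := ae m.
  by rewrite ler_norml => /andP[]; lra.
have dn n m : (n <= m)%N -> a m + e m <= a n + e n.
  elim: m => [|m IH]; first by rewrite leqn0 => /eqP ->.
  rewrite leq_eqVlt => /predU1P[->//|/IH]; have := ae m.
  by rewrite ler_norml => /andP[]; lra.
have ud n m : a n - e n <= a m + e m.
  have := up _ _ (leq_maxl n m); have := dn _ _ (leq_maxr n m).
  by have := e0 (maxn n m); lra.
exists (sup (range (fun n => a n - e n))) => n.
rewrite ler_norml; apply/andP; split.
  rewrite lerBrDl; apply: ub_le_sup; last by exists n.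
  by exists (a 0%N + e 0%N) => _ [m _ <-]; exact: ud.
rewrite lerBlDl; apply: ge_sup; first by exists (a 0%N - e 0%N), 0%N.
by move=> _ [m _ <-]; exact: ud.
Qed.

(** The factor 2 comes from recombining the real and the imaginary part. *)
Lemma telescoping_limit (a : nat -> K^o) (e : nat -> R) :
  (forall n, 0 <= e n) -> (forall n, rnorm (a n.+1 - a n) <= e n - e n.+1) ->
  exists l : K^o, forall n, rnorm (l - a n) <= 2 * e n.
Proof.
move=> e0; move: (@scalar_rnormE R k) a; case: k => normE a ae.
  have [n|l lP] := @real_telescoping_limit a e e0.
    by have := ae n; rewrite normE.
  by exists l => n; have := lP n; have := e0 n; rewrite normE; lra.
have le_norm (z : (scalar_field R ComplexScalars)^o) :
    `|complex.Re z| <= rnorm z /\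
    `|complex.Im z| <= rnorm z.
  rewrite normE; split; rewrite -sqrtr_sqr ler_wsqrtr//.
    by rewrite lerDl sqr_ge0.
  by rewrite lerDr sqr_ge0.
have [n|l1 l1P] := @real_telescoping_limit (fun n => complex.Re (a n)) e e0.
  by rewrite -raddfB (le_trans _ (ae n))//; case: (le_norm (a n.+1 - a n)).
have [n|l2 l2P] := @real_telescoping_limit (fun n => complex.Im (a n)) e e0.
  by rewrite -raddfB (le_trans _ (ae n))//; case: (le_norm (a n.+1 - a n)).
exists (l1 +i* l2)%C => n; rewrite normE.
have := l1P n; have := l2P n; case: (a n) => x y /= xe ye.
rewrite -(ler_sqr (_ : _ \in Num.nneg)) ?nnegrE ?sqrtr_ge0 ?mulr_ge0//.
rewrite sqr_sqrtr ?addr_ge0 ?sqr_ge0//.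
rewrite -[(l1 - x) ^+ 2]real_normK ?num_real//.
rewrite -[(l2 - y) ^+ 2]real_normK ?num_real//.
have := normr_ge0 (l1 - x); have := normr_ge0 (l2 - y); have := e0 n.
by nra.
Qed.

Lemma geometric_bound_eq0 (x C : R) :
  0 <= x -> (forall n, x <= C * 9%:R ^- n) -> x = 0.
Proof.
move=> x0 xC; apply/eqP; rewrite eq_le x0 andbT leNgt; apply/negP => xgt0.
have C0 : 0 < C by have := xC 0%N; rewrite expr0 invr1 mulr1; lra.
have [n nP] : exists n : nat, C / x < n%:R.
  exists (Num.truncn (C / x)).+1; exact: truncnS_gt.
have : (n%:R : R) < 9%:R ^+ n by rewrite -natrX ltr_nat ltn_expl.
move=> n9; have := xC n.
rewrite -ler_pdivrMr ?exprn_gt0//.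
rewrite ltr_pdivrMr// in nP.
rewrite invrK => H.
have : n%:R * x < x * 9%:R ^+ n by rewrite mulrC ltr_pM2l.
by lra.
Qed.

Lemma near_max (A : set R) (B : R) : has_ubound A -> 0 < B ->
  (exists2 a, A a & B < a) ->
  exists a, [/\ A a, B <= a & forall b, A b -> b <= 2 * a].
Proof.
move=> Aub B0 [a0 Aa0 Ba0].
have supA : has_sup A by split => //; exists a0.
have a0s : a0 <= sup A by exact: ub_le_sup.
have eps : 0 < Num.min (sup A / 2) (sup A - B).
  by rewrite lt_min; apply/andP; split; lra.
have [a Aa] := sup_adherent eps supA.
have [m1 m2] : Num.min (sup A / 2) (sup A - B) <= sup A / 2 /\
   Num.min (sup A / 2) (sup A - B) <= sup A - B.
  by rewrite !ge_min !lexx orbT.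
move=> sa; exists a; split => //; first by lra.
by move=> b Ab; have : b <= sup A by [exact: ub_le_sup]; lra.
Qed.

Lemma lp_partial_sums (V : normedModType K) (p : nat) (x : nat -> V) :
  (0 < p)%N -> lp p%:R x ->
  exists M : R, forall N, \sum_(j < N) rnorm (x j) ^+ p <= M.
Proof.
move=> p0; rewrite /lp/= => xp.
have pos (j : nat) : (0 <= (rnorm (x j) `^ p%:R)%:E)%E.
  by rewrite lee_fin powR_ge0.
have fin : (\sum_(0 <= j <oo) (rnorm (x j) `^ p%:R)%:E \is a fin_num)%E.
  by rewrite ge0_fin_numE// nneseries_ge0.
exists (fine (\sum_(0 <= j <oo) (rnorm (x j) `^ p%:R)%:E)%E) => N.
rewrite -lee_fin fineK//.
apply: le_trans (nneseries_lim_ge N (fun j _ _ => pos j)).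
rewrite big_mkord sumEFin lee_fin ler_sum// => j _.
by rewrite powR_mulrn ?rnorm_ge0.
Qed.

Context {V : normedModType K}.
Variables (p : nat) (x : nat -> V).
Hypothesis p12 : (0 < p <= 2)%N.

Definition power_sum (N : nat) (phi : V -> K^o) : R :=
  \sum_(j < N) rnorm (phi (x j)) ^+ p.

Lemma power_sum_ge0 N phi : 0 <= power_sum N phi.
Proof. by apply: sumr_ge0 => j _; rewrite exprn_ge0 ?rnorm_ge0. Qed.

Lemma power_sumZ N (c : R) (phi psi : V -> K^o) :
  (forall v, phi v = of_real c * psi v) ->
  power_sum N phi = `|c| ^+ p * power_sum N psi.
Proof.
move=> E; rewrite /power_sum mulr_sumr; apply: eq_bigr => j _.
by rewrite E rnormM rnorm_of_real exprMn.
Qed.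

Lemma power_sumD N (f g h : V -> K^o) :
  (forall v, f v = g v + h v) ->
  power_sum N f <= 2 ^+ p.-1 * (power_sum N g + power_sum N h).
Proof.
move=> E; rewrite /power_sum -big_split mulr_sumr; apply: ler_sum => j _ /=.
have : rnorm (f (x j)) <= rnorm (g (x j)) + rnorm (h (x j)).
  by rewrite E rnormD.
move: (rnorm_ge0 (f (x j))) (rnorm_ge0 (g (x j))) (rnorm_ge0 (h (x j))).
case: p p12 => [|[|[|//]]] //= _; first by rewrite expr0 mul1r !expr1.
set F := rnorm _; set G := rnorm _; set H := rnorm _ => F0 G0 H0 FGH.
have : F ^+ 2 <= (G + H) ^+ 2 by rewrite lerXn2r ?nnegrE ?addr_ge0.
by have := sqr_ge0 (G - H); rewrite sqrrB sqrrD; lra.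
Qed.

(** Convexity: [2 g] is the difference of [f + g] and [f - g], so one of the two
    has a power sum at least that of [g]. A perturbation of prescribed size can
    therefore always be added to [f] without cancellation. *)
Lemma power_sum_sign N (f g : V -> K^o) :
  exists s : R, `|s| = 1 /\
    power_sum N g <= power_sum N (fun v => f v + of_real s * g v).
Proof.
have E1 := @power_sumD N (fun v => of_real 2 * g v)
  (fun v => f v + of_real 1 * g v) (fun v => - (f v + of_real (-1) * g v)).
have E2 : power_sum N (fun v => - (f v + of_real (-1) * g v)) =
          power_sum N (fun v => f v + of_real (-1) * g v).
  rewrite (@power_sumZ _ (-1) _ (fun v => f v + of_real (-1) * g v)).
    by rewrite normrN1 expr1n mul1r.
  by move=> v; rewrite rmorphN1 !mulN1r.
have {E1}: 2 ^+ p * power_sum N g <= 2 ^+ p.-1 *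
    (power_sum N (fun v => f v + of_real 1 * g v) +
     power_sum N (fun v => f v + of_real (-1) * g v)).
  have := @power_sumZ N 2 (fun v => of_real 2 * g v) g (fun=> erefl).
  rewrite ger0_norm// => <-; rewrite -[in leRHS]E2.
  apply: E1 => v.
  rewrite rmorphN1 rmorph1 rmorphD/= rmorph1 mulrDl mul1r mulN1r.
  by rewrite opprD opprK addrACA subrr add0r.
have -> : (2 : R) ^+ p = 2 ^+ p.-1 * 2.
  by rewrite -exprSr prednK//; case/andP: p12.
rewrite -mulrA ler_pM2l ?exprn_gt0// => E.
have [H|H] := leP (power_sum N g)
    (power_sum N (fun v => f v + of_real 1 * g v)).
  by exists 1; rewrite normr1.
by exists (-1); rewrite normrN1; split=> //; lra.
Qed.

Definition contractive (phi : {linear V -> K^o}) :=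
  forall v, rnorm (phi v) <= rnorm v.

Lemma power_sum_contractive N (phi : {linear V -> K^o}) :
  contractive phi -> power_sum N phi <= \sum_(j < N) rnorm (x j) ^+ p.
Proof.
move=> phi1; apply: ler_sum => j _.
by rewrite lerXn2r ?nnegrE ?rnorm_ge0// phi1.
Qed.

Lemma near_extremal_functional :
  (forall W, exists (phi : {linear V -> K^o}) N,
     contractive phi /\ W < power_sum N phi) ->
  forall W, 0 < W -> exists z : nat * {linear V -> K^o},
    [/\ contractive z.2, W <= power_sum z.1 z.2 &
      forall phi, contractive phi ->
        power_sum z.1 phi <= 2 * power_sum z.1 z.2].
Proof.
move=> unb W W0; have [phi0 [N [phi01 WN]]] := unb W.
have [|//||a [[phi phi1 <-] Wa maxa]] :=
    @near_max [set power_sum N phi | phi in contractive] W.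
- exists (\sum_(j < N) rnorm (x j) ^+ p) => _ [phi phi1 <-].
  exact: power_sum_contractive.
- by exists (power_sum N phi0) => //; exists phi0.
- by exists (N, phi); split=> //= psi psi1; apply: maxa; exists psi.
Qed.

(** A gliding-hump form of the uniform boundedness principle. If the bound
    failed, there would be contractive [phi_n], almost extremal for the partial
    power sum of some length [N_n], with values growing as fast as desired. The
    series of the [9^-n phi_n], with signs chosen one at a time so that the
    [n]-th term is not cancelled by the preceding ones, converges to a bounded
    functional. Its tail after [n] has norm at most [9^-n / 4], so by almost
    extremality it destroys only part of the contribution of [phi_n]; the power
    sums of the limit are then unbounded, against weak summability. *)
Theorem weakly_summable_bounded : lpw p%:R x ->
  exists W : R, forall phi : {linear V -> K^o}, contractive phi ->
    forall N, power_sum N phi <= W.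
Proof.
have p0 : (0 < p)%N by case/andP: p12.
move=> xw; apply: contrapT => nW.
have unb : forall W, 0 < W -> exists z : nat * {linear V -> K^o},
    [/\ contractive z.2, W <= power_sum z.1 z.2 &
      forall phi, contractive phi ->
        power_sum z.1 phi <= 2 * power_sum z.1 z.2].
  apply: near_extremal_functional => W.
  apply: contrapT => H; apply: nW; exists W => phi phi1 N.
  by rewrite leNgt; apply/negP => lt; apply: H; exists phi, N.
(* [9 ^+ n] to the power [p] compensates the scaling of the [n]-th term, and
   the factor 4 what convexity and the tail lose. *)
pose B (n : nat) : R := 4 * n.+1%:R * (9 ^+ n) ^+ p.
have B0 n : 0 < B n by rewrite !mulr_gt0 ?exprn_gt0.
have [z zP] := choice (fun n => unb (B n) (B0 n)).
have [sg sgP] := choice (fun nf : nat * (V -> K^o) =>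
  power_sum_sign (z nf.1).1 nf.2 (fun v => of_real (9 ^- nf.1) * (z nf.1).2 v)).
pose psi : nat -> V -> K^o := nat_rect (fun _ => V -> K^o) (fun _ => 0)
  (fun n f v => f v + of_real (sg (n, f)) * (of_real (9 ^- n) * (z n).2 v)).
have psiS n v : psi n.+1 v =
  psi n v + of_real (sg (n, psi n)) * (of_real (9 ^- n) * (z n).2 v) by [].
have psi_lin n : linear (psi n).
  elim: n => [|n IH] a u v; first by rewrite /= scaler0 addr0.
  rewrite !psiS IH linearP scalerDr !mulrDr addrACA; congr (_ + _ + (_ + _)).
  by rewrite /GRing.scale/= !(mulrCA a).
pose e (n : nat) (v : V) : R := 9 / 8 * 9 ^- n * rnorm v.
have p9 n : 0 <= (9 : R) ^- n by rewrite invr_ge0 exprn_ge0.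
have e0 v n : 0 <= e n v by rewrite !mulr_ge0 ?rnorm_ge0.
have eS v n : rnorm (psi n.+1 v - psi n v) <= e n v - e n.+1 v.
  rewrite psiS addrC addKr !rnormM !rnorm_of_real (sgP (n, psi n)).1 mul1r.
  rewrite ger0_norm//.
  have [zc _ _] := zP n.
  have := ler_wpM2l (p9 n) (zc v); rewrite /e exprS invfM.
  have : (9 : R) * 9^-1 = 1 by rewrite mulfV.
  set q := _^-1; set i := 9 ^- n; move: (rnorm _) (rnorm v) => s t E.
  by rewrite (_ : q = 9^-1)//; lra.
have [psiL psiLP] := choice (fun v => telescoping_limit (e0 v) (eS v)).
have psiL_lin : linear psiL.
  move=> a u v; apply/eqP; rewrite -subr_eq0; apply/eqP/rnorm_eq0.
  pose r := rnorm (a *: u + v) + rnorm (a : K^o) * rnorm u + rnorm v.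
  apply: (@geometric_bound_eq0 _ (9 / 4 * r)); first exact: rnorm_ge0.
  move=> n.
  have -> : psiL (a *: u + v) - (a *: psiL u + psiL v) =
     (psiL (a *: u + v) - psi n (a *: u + v)) -
     (a *: (psiL u - psi n u) + (psiL v - psi n v)).
    rewrite psi_lin scalerBr [in RHS]addrACA -opprD opprB.
    by rewrite addrA subrK.
  apply: le_trans (rnormD _ _) _; rewrite rnormN.
  have H1 := rnormD (a *: (psiL u - psi n u)) (psiL v - psi n v).
  rewrite rnormZ in H1.
  have H2 := psiLP (a *: u + v) n; have H3 := psiLP v n.
  have H4 := ler_wpM2l (rnorm_ge0 (a : K^o)) (psiLP u n).
  by rewrite /r; rewrite /e in H2 H3 H4; lra.
pose PL : {linear V -> K^o} :=
  HB.pack psiL (GRing.isLinear.Build K V K^o _ psiL psiL_lin).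
have PLb : bounded_functional PL.
  exists (of_real (9 / 4)) => v; rewrite le_rnormP.
  by have := psiLP v 0%N; rewrite subr0 /e expr0 invr1; lra.
have [M PM] := lp_partial_sums p0 (xw _ PLb).
have {}PM N : power_sum N psiL <= M by exact: PM.
have [n nM] : exists n : nat, M < n.+1%:R.
  by exists (Num.truncn M); exact: truncnS_gt.
have := PM (z n).1; apply/negP; rewrite -ltNge; apply: lt_le_trans nM _.
have [zc zB zmax] := zP n.
set Q := power_sum (z n).1; set q := Q (z n).2.
have low : 9 ^- (n * p) * q <= Q (psi n.+1).
  apply: le_trans (sgP (n, psi n)).2.
  by rewrite (@power_sumZ _ (9 ^- n) _ (z n).2)// ger0_norm// exprVn -exprM.
have err : Q (fun v => - (psiL v - psi n.+1 v)) <=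
    (4^-1 * 9 ^- n) ^+ p * (2 * q).
  (* [chi] is the tail rescaled to a contraction, to which the almost
     extremality of [z n] applies. *)
  pose chi (v : V) : K^o := of_real (- (4 * 9 ^+ n)) * (psiL v - psi n.+1 v).
  have chi_lin : linear chi.
    move=> a u v; rewrite /chi psiL_lin psi_lin opprD addrACA -scalerBr mulrDr.
    by congr (_ + _); rewrite /GRing.scale/= mulrCA.
  pose CL : {linear V -> K^o} :=
    HB.pack chi (GRing.isLinear.Build K V K^o _ chi chi_lin).
  have c0 : (4 * 9 ^+ n : R) != 0 by rewrite mulf_neq0// expf_neq0.
  have CLc : contractive CL.
    move=> v; rewrite /= /chi rnormM rnorm_of_real normrN ger0_norm; last first.
      by rewrite mulr_ge0// exprn_ge0.
    rewrite -ler_pdivlMl; last by rewrite mulr_gt0// exprn_gt0.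
    apply: le_trans (psiLP v n.+1) _; rewrite /e exprS !invfM.
    by have := p9 n; have := rnorm_ge0 v; nra.
  rewrite /Q (@power_sumZ _ (4^-1 * 9 ^- n) _ chi) => [|v].
    rewrite ger0_norm ?mulr_ge0// ler_wpM2l ?exprn_ge0 ?mulr_ge0//.
    exact: (zmax CL CLc).
  rewrite /chi mulrA -rmorphM/= mulrN -invfM mulVf// rmorphN1 mulN1r//.
have tri : Q (psi n.+1) <=
    2 ^+ p.-1 * (Q psiL + Q (fun v => - (psiL v - psi n.+1 v))).
  by apply: power_sumD => v; rewrite opprB addrC subrK.
have q0 : 0 <= q by exact: power_sum_ge0.
have P0 : 0 <= Q psiL by exact: power_sum_ge0.
have qB : B n * 9 ^- (n * p) <= q * 9 ^- (n * p) by rewrite ler_wpM2r.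
have BE : B n * 9 ^- (n * p) = 4 * n.+1%:R.
  by rewrite /B -exprM -mulrA mulfV ?mulr1// expf_neq0.
rewrite BE in qB; move: low err qB tri.
rewrite exprMn [9 ^- n ^+ p]exprVn -exprM.
have := p9 (n * p)%N; set i := 9 ^- (n * p) => i0.
have iq0 : 0 <= i * q by rewrite mulr_ge0.
case: p p12 => [|[|[|//]]] //= _; rewrite ?expr0 ?expr1; lra.
Qed.

End UniformBoundedness.

(** * Factorization through finite-dimensional sup-norm spaces *)

Section Factorization.
Context {R : realType} {k : scalars}.
Local Notation K := (scalar_field R k).

Lemma rnorm_coord d (v : 'rV[K]_d) t : rnorm (v 0 t : K^o) <= rnorm v.
Proof.
rewrite -(@le_of_real R k) -!normE.
have le_mx (F : numDomainType) (w : 'rV[F]_d) : `|w 0 t| <= mx_norm w.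
  rewrite mx_normE -[leLHS]nngE num_le.
  exact: (le_bigmax _ (fun i => `|w i.1 i.2|%:nng) (0, t)).
exact: le_mx.
Qed.

Lemma rnorm_row_le d (v : 'rV[K]_d) (c : R) :
  0 <= c -> (forall t, rnorm (v 0 t : K^o) <= c) -> rnorm v <= c.
Proof.
move=> c0 vc; have [->|v0] := eqVneq (rnorm v) 0; first by [].
have nv0 : mx_norm v != 0.
  apply: contra_neq v0; rewrite -[mx_norm v]/(`|v|) /rnorm => ->.
  by rewrite raddf0.
have [[i t] /= vt] := mx_norm_neq0 nv0.
rewrite -(@le_of_real R k) -normE [`|v|]vt (ord1 i).
by rewrite (normE (v 0 t : K^o)) le_of_real.
Qed.

(** In [C(K)] the weak 2-summing norm of a finite family is the supremum over
    the points of the [l2] norms of the values; here the points are the [d]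
    coordinates, and [c] bounds the square. *)
Definition l2_family d N (x : nat -> 'rV[K]_d) (c : R) :=
  forall t, \sum_(j < N) rnorm (x j 0 t : K^o) ^+ 2 <= c.

Context {V : normedModType K}.

Lemma norming_functional (z : V) :
  exists phi : {linear V -> K^o}, contractive phi /\ rnorm (phi z) = rnorm z.
Proof.
pose u (a : K^o) : V := a *: z.
have ulin : linear u by move=> a b c; rewrite /u scalerDl scalerA.
pose g (a : K^o) : K^o := a * of_real (rnorm z).
have glin : linear g by move=> a b c; rewrite /g mulrDl scalerAl.
pose uL : {linear K^o -> V} :=
  HB.pack u (GRing.isLinear.Build K K^o V _ u ulin).
pose gL : {linear K^o -> K^o} :=
  HB.pack g (GRing.isLinear.Build K K^o K^o _ g glin).
have [a|phi [phi1 phiu]] := @hahn_banach R k V K^o uL gL 1 ler01.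
  by rewrite /= /u /g rnormM rnorm_of_real rnormZ mul1r ger0_norm// rnorm_ge0.
exists phi; split=> [v|]; first by have := phi1 v; rewrite mul1r.
have := phiu 1; rewrite /= /u /g scale1r mul1r => ->.
by rewrite rnorm_of_real ger0_norm// rnorm_ge0.
Qed.

(** Both kinds of sequences in the main theorem have this property, and it is
    all that is kept of them: the initial segments are images of weakly
    2-summable families of finite-dimensional sup-norm spaces, with a constant
    [D] that does not depend on their length. *)
Definition linf_factorable (x : nat -> V) := exists D : R, forall N : nat,
  exists d (u : {linear 'rV[K]_d -> V}) (y : nat -> 'rV[K]_d),
    [/\ forall v, rnorm (u v) <= D * rnorm v,
        forall j, (j < N)%N -> u (y j) = x j & l2_family N y 1].

(** The map sending the unit vectors to the [x j] is bounded, since a norming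
    functional reduces the norm of [\sum_j v_j x_j] to a weak [l1] sum; the
    unit vectors themselves form an [l2] family of constant 1. *)
Lemma lpw1_factorable (x : nat -> V) : lpw 1 x -> linf_factorable x.
Proof.
move=> x1; have [//|W WP] := @weakly_summable_bounded R k V 1 x isT.
exists W => N.
pose u (v : 'rV[K]_N) : V := \sum_j v 0 j *: x j.
have ulin : linear u.
  move=> a v w; rewrite /u scaler_sumr -big_split; apply: eq_bigr => j _ /=.
  by rewrite !mxE scalerDl scalerA.
pose uL : {linear 'rV[K]_N -> V} :=
  HB.pack u (GRing.isLinear.Build K 'rV[K]_N V _ u ulin).
exists N, uL, (fun j => \row_t (t == j :> nat)%:R); split.
- move=> v; have [phi [phi1 <-]] := norming_functional (uL v).
  have phiW := WP phi phi1 N; rewrite /power_sum in phiW.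
  rewrite /= /u linear_sum/=.
  apply: le_trans (rnorm_sum _ _ _) _.
  rewrite mulrC; apply: le_trans (ler_wpM2l (rnorm_ge0 v) phiW).
  rewrite mulr_sumr; apply: ler_sum => j _.
  rewrite linearZ rnormZ expr1 ler_wpM2r ?rnorm_ge0//.
  exact: rnorm_coord.
- move=> j jN; rewrite /= /u (bigD1 (Ordinal jN))//= big1 => [|i ij].
    by rewrite mxE eqxx scale1r addr0.
  by rewrite mxE (negbTE (ij : i != j :> nat)) scale0r.
- move=> t; rewrite (bigD1 t)//= big1 => [|i it].
    by rewrite mxE eqxx rnorm1 expr1n addr0.
  by rewrite mxE eq_sym (negbTE (it : i != t :> nat)) rnorm0 expr0n.
Qed.

Lemma spanned_by_indep (x : nat -> V) N : exists m (e : 'I_m -> V),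
  lin_indep e /\ forall j, (j < N)%N -> spanned_by e (x j).
Proof.
elim: N => [|N [m [e [ie se]]]].
  by exists 0%N, (fun _ => 0); split=> // a _ [].
have [xe|nxe] := pselect (spanned_by e (x N)).
  exists m, e; split=> // j; rewrite ltnS leq_eqVlt => /predU1P[->//|].
  exact: se.
pose e' (i : 'I_m.+1) : V := if unlift ord_max i is Some l then e l else x N.
have e'w i : e' (widen_ord (leqnSn m) i) = e i.
  rewrite /e' (_ : widen_ord _ i = lift ord_max i) ?liftK//.
  by apply/val_inj; rewrite /= /bump leqNgt ltn_ord.
have e'm : e' ord_max = x N by rewrite /e' unlift_none.
have sumE (a : 'I_m.+1 -> K) : \sum_i a i *: e' i =
    \sum_i a (widen_ord (leqnSn m) i) *: e i + a ord_max *: x N.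
  rewrite big_ord_recr/= e'm; congr (_ + _).
  by apply: eq_bigr => i _; rewrite e'w.
exists m.+1, e'; split.
  move=> a; rewrite sumE => a0.
  have am0 : a ord_max = 0.
    apply/eqP/negPn/negP => am; apply: nxe.
    exists (fun i => - (a ord_max)^-1 * a (widen_ord (leqnSn m) i)) => //.
    under eq_bigr do rewrite -scalerA.
    rewrite -scaler_sumr; move/eqP: a0; rewrite addr_eq0 => /eqP ->.
    by rewrite scalerN scaleNr opprK scalerA mulVf// scale1r.
  move: a0; rewrite am0 scale0r addr0 => /ie a0 i.
  have [j ->|->] := unliftP ord_max i; last exact: am0.
  have := a0 j; rewrite (_ : widen_ord _ j = lift ord_max j)//.
  by apply/val_inj; rewrite /= /bump leqNgt ltn_ord.
move=> j; rewrite ltnS leq_eqVlt => /predU1P[->|/se[a _ <-]].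
  exists (fun i => (i == ord_max)%:R) => //.
  rewrite (bigD1 ord_max)//= eqxx scale1r e'm big1 ?addr0// => i /negPf ->.
  by rewrite scale0r.
exists (fun i => if unlift ord_max i is Some l then a l else 0) => //.
rewrite sumE unlift_none scale0r addr0; apply: eq_bigr => i _.
rewrite (_ : widen_ord _ i = lift ord_max i) ?liftK//.
by apply/val_inj; rewrite /= /bump leqNgt ltn_ord.
Qed.

Lemma unit_ball (W : normedModType K) (w : W) : (`|w| <= 1) = (rnorm w <= 1).
Proof. by rewrite normE -(rmorph1 (@of_real R k)) le_of_real. Qed.

Section Operator.
Context {W : normedModType K} (u : {linear W -> V}).

Lemma op_normP a v : (op_norm u <= a%:E)%E -> rnorm (u v) <= a * rnorm v.
Proof.
move=> ua; have [->|v0] := eqVneq v 0; first by rewrite linear0 !rnorm0 mulr0.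
have nv : 0 < rnorm v.
  by rewrite lt_def rnorm_ge0 andbT; apply: contra_neq v0; exact: rnorm_eq0.
have iv : 0 <= (rnorm v)^-1 by rewrite invr_ge0 ltW.
rewrite mulrC -ler_pdivrMl// -{1}(ger0_norm iv).
rewrite -rnormZr -linearZ -lee_fin; apply: le_trans ua; apply: ereal_sup_ubound.
eexists; last reflexivity.
by rewrite /= unit_ball rnormZr ger0_norm// mulVf ?gt_eqF.
Qed.

Lemma inv_op_normP b v : injective u -> (inv_op_norm u <= b%:E)%E ->
  rnorm v <= b * rnorm (u v).
Proof.
move=> inju ub.
have [->|v0] := eqVneq v 0; first by rewrite linear0 !rnorm0 mulr0.
have nv : 0 < rnorm (u v).
  rewrite lt_def rnorm_ge0 andbT; apply: contra_neq v0 => /rnorm_eq0.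
  by rewrite -(linear0 u) => /inju.
have iv : 0 <= (rnorm (u v))^-1 by rewrite invr_ge0 ltW.
rewrite mulrC -ler_pdivrMl// -{1}(ger0_norm iv).
rewrite -rnormZr -lee_fin; apply: le_trans ub; apply: ereal_sup_ubound.
eexists; last reflexivity.
by rewrite /= unit_ball linearZ rnormZr ger0_norm// mulVf ?gt_eqF.
Qed.

(** A finite product of extended reals does not make its factors finite, because
    [0 * +oo = 0]; a nonzero vector excludes this, both norms then being
    positive. *)
Lemma isomorphism_constants c : injective u -> (exists w : W, w != 0) ->
  (op_norm u * inv_op_norm u < c%:E)%E ->
  exists a b : R, [/\ 0 < a, 0 < b, a * b < c,
    forall v, rnorm (u v) <= a * rnorm v &
    forall v, rnorm v <= b * rnorm (u v)].
Proof.
move=> inju [w w0] uc.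
have nw : 0 < rnorm w.
  by rewrite lt_def rnorm_ge0 andbT; apply: contra_neq w0; exact: rnorm_eq0.
have nuw : 0 < rnorm (u w).
  rewrite lt_def rnorm_ge0 andbT; apply: contra_neq w0 => /rnorm_eq0.
  by rewrite -(linear0 u) => /inju.
have u0 : (0 < op_norm u)%E.
  rewrite ltNge; apply/negP => H; have := op_normP w H.
  by rewrite mul0r leNgt nuw.
have v0 : (0 < inv_op_norm u)%E.
  rewrite ltNge; apply/negP => /(inv_op_normP w inju).
  by rewrite mul0r leNgt nw.
move: (@op_normP) (@inv_op_normP) u0 v0 uc.
case: (op_norm u) => [a| |]; case: (inv_op_norm u) => [b| |] //.
- move=> H1 H2; rewrite !lte_fin => a0 b0 abc; exists a, b; split=> // v.
    exact: H1.
  exact: H2.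
- by move=> _ _ a0 _; rewrite gt0_muley.
- by move=> _ _ _ b0; rewrite gt0_mulye.
Qed.

End Operator.

(** The first [N] terms lie in a subspace [G] that [u] identifies with a
    sup-norm space. The coordinate functionals of [G] have norm at most the norm
    [b] of the inverse and extend to [V] by the Hahn-Banach theorem, where weak
    2-summability bounds them on the sequence: the coordinate vectors form an
    [l2] family of constant of order [b], which is moved into the map [u]. Only
    the product of the two norms enters, and it is controlled by the
    Banach-Mazur distance. *)
Lemma Linfty_lpw2_factorable (x : nat -> V) :
  Linfty_space V -> lpw 2 x -> linf_factorable x.
Proof.
move=> [l [l1 VP]] x2.
have [//|W0 WP0] := @weakly_summable_bounded R k V 2 x isT.
pose W := Num.max W0 0.
have W_ge0 : 0 <= W by rewrite le_max lexx orbT.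
have WP phi : contractive phi -> forall N, power_sum 2 x N phi <= W.
  by move=> c N; rewrite le_max WP0.
exists ((l + 1) * (W + 1)) => N.
have [m [e [ie se]]] := spanned_by_indep x N.
have [|G [d [_ eG GBM]]] := VP (spanned_by e) m; first by exists e.
have : (banach_mazur 'rV[K]_d G < (l + 1)%:E)%E.
  by rewrite (le_lt_trans GBM)// lte_fin ltrDl.
move=> /ereal_inf_lt[_ [u [inju ranu] <-]] uc.
have xG (j : nat) : exists y, (j < N)%N -> u y = x j.
  have [jN|] := ltnP j N; last by exists 0.
  have : G (x j) by apply: eG; exact: se.
  by rewrite -ranu => -[y _ <-]; exists y.
have [y uy] := choice xG.
(* In the zero space the operator norms carry no information. *)
have [rV0|] := pselect (exists w : 'rV[K]_d, w != 0); last first.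
  move=> triv; have z0 (w : 'rV[K]_d) : w = 0.
    by apply/eqP/negPn/negP => w0; apply: triv; exists w.
  exists d, u, y; split=> // [v|t].
    by rewrite (z0 v) linear0 !rnorm0 mulr0.
  by rewrite big1// => j _; rewrite (z0 (y j)) mxE rnorm0 expr0n.
have [a [b [a0 b0 abl ua ub]]] := isomorphism_constants inju rV0 uc.
pose s := b * (W + 1).
have W1 : 0 < W + 1 by lra.
have s0 : 0 < s by rewrite mulr_gt0.
have uslin : linear (fun v => of_real s *: u v).
  move=> c v w; rewrite linearP scalerDr !scalerA; congr (_ *: _ + _).
  by rewrite mulrC.
pose us : {linear 'rV[K]_d -> V} :=
  HB.pack (fun v => of_real s *: u v)
    (GRing.isLinear.Build K 'rV[K]_d V _ _ uslin).
exists d, us, (fun j => of_real s^-1 *: y j); split.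
- move=> v; rewrite /= rnormZr gtr0_norm// /s.
  have := ler_wpM2l (ltW s0) (ua v) => /le_trans; apply.
  rewrite mulrA ler_wpM2r ?rnorm_ge0// /s mulrAC ler_wpM2r ?(ltW W1)//.
  by rewrite mulrC ltW.
- move=> j jN; rewrite /= linearZ scalerA -rmorphM/= mulfV ?gt_eqF//.
  by rewrite rmorph1 scale1r uy.
move=> t; pose g (v : 'rV[K]_d) : K^o := v 0 t.
have glin : linear g by move=> c v w; rewrite /g !mxE.
pose gL : {linear 'rV[K]_d -> K^o} :=
  HB.pack g (GRing.isLinear.Build K 'rV[K]_d K^o _ g glin).
have [v|phi [phib phiu]] := @hahn_banach R k V 'rV[K]_d u gL b (ltW b0).
  exact: le_trans (rnorm_coord v t) (ub v).
pose psi v : K^o := of_real b^-1 * phi v.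
have psilin : linear psi.
  move=> c v w; rewrite /psi linearP mulrDr; congr (_ + _).
  by rewrite /GRing.scale/= mulrCA.
pose psiL : {linear V -> K^o} :=
  HB.pack psi (GRing.isLinear.Build K V K^o _ psi psilin).
have psi1 : contractive psiL.
  move=> v; rewrite /= /psi rnormM rnorm_of_real gtr0_norm ?invr_gt0//.
  by rewrite ler_pdivrMl// phib.
apply: le_trans (_ : (W + 1) ^- 2 * power_sum 2 x N psiL <= 1).
  rewrite /power_sum mulr_sumr; apply: ler_sum => j _.
  rewrite /= /psi -(uy j (ltn_ord j)) phiu /= /g mxE.
  rewrite !rnormM !rnorm_of_real !gtr0_norm ?invr_gt0//.
  by rewrite /s invfM !exprMn !exprVn; lra.
rewrite ler_pdivrMl ?exprn_gt0// mulr1.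
by apply: le_trans (WP _ psi1 N) _; nra.
Qed.

End Factorization.

(** * Rademacher sums and truncation *)

Section Rademacher.
Context {R : realType} {k : scalars}.
Local Notation K := (scalar_field R k).

(** Sign patterns are lists, so that moments of Rademacher sums follow by
    induction on the number of signs, peeling off the first one. Sums over
    [signs N] are not normalized; expectations carry the factor [2 ^- N]. *)
Fixpoint signs (N : nat) : seq (seq bool) :=
  if N is N'.+1 then map (cons false) (signs N') ++ map (cons true) (signs N')
  else [:: [::]].

Definition sign_at (w : seq bool) (j : nat) : R := (-1) ^+ nth false w j.

Lemma big_signsS (M : nmodType) N (F : seq bool -> M) :
  \sum_(w <- signs N.+1) F w =
  \sum_(w <- signs N) (F (false :: w) + F (true :: w)).
Proof. by rewrite big_split/= big_cat/= !big_map. Qed.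

Lemma size_signs N : size (signs N) = (2 ^ N)%N.
Proof.
by elim: N => //= N IH; rewrite size_cat !size_map IH expnS mul2n addnn.
Qed.

Lemma norm_sign_at w j : `|sign_at w j| = 1.
Proof. by rewrite normrX normrN1 expr1n. Qed.

Lemma sum_sign_atM N i j : (i < N)%N -> (j < N)%N ->
  \sum_(w <- signs N) sign_at w i * sign_at w j = 2 ^+ N *+ (i == j).
Proof.
elim: N i j => // N IH i j; rewrite big_signsS.
case: i j => [|i] [|j] iN jN.
- under eq_bigr do rewrite /sign_at/= !expr0 expr1 mulN1r opprK mul1r.
  rewrite big_const_seq count_predT size_signs iter_addr_0.
  by rewrite -[LHS]mulr_natl natrX exprSr.
- by rewrite big1// => w _; rewrite /sign_at/= expr0 expr1 mul1r mulN1r addrN.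
- by rewrite big1// => w _; rewrite /sign_at/= expr0 expr1 mulr1 mulrN1 addrN.
- by rewrite big_split/= IH// -mulr2n eqSS exprS -mulrnAr mulr_natl.
Qed.

Definition rademacher (V : lmodType K) N (x : nat -> V) (w : seq bool) : V :=
  \sum_(j < N) of_real (sign_at w j) *: x j.

Lemma rademacherS (V : lmodType K) N (x : nat -> V) b w :
  rademacher N.+1 x (b :: w) =
  (if b then - x 0%N else x 0%N) + rademacher N (x \o S) w.
Proof.
rewrite /rademacher big_ord_recl; congr (_ + _).
by case: b; rewrite /sign_at/= (expr0, expr1) (rmorph1, rmorphN1)
  (scale1r, scaleN1r).
Qed.

Lemma rademacher_coef (V : lmodType K) N (x : nat -> V) j : (j < N)%N ->
  x j = of_real (2 ^- N) *:
    \sum_(w <- signs N) of_real (sign_at w j) *: rademacher N x w.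
Proof.
move=> jN; under eq_bigr do rewrite scaler_sumr.
rewrite exchange_big/=.
under eq_bigr do (under eq_bigr do rewrite scalerA -rmorphM/=;
  rewrite -scaler_suml -rmorph_sum/= sum_sign_atM//).
rewrite (bigD1 (Ordinal jN))//= eqxx big1 ?addr0 => [|i ij].
  by rewrite scalerA -rmorphM/= mulVf ?rmorph1 ?scale1r// expf_neq0.
have -> : (j == i :> nat) = false by rewrite eq_sym; exact: negbTE ij.
by rewrite mulr0n rmorph0 scale0r.
Qed.

Lemma rademacher_moment2 N (z : nat -> K^o) :
  \sum_(w <- signs N) rnorm (rademacher N z w) ^+ 2 =
  2 ^+ N * \sum_(j < N) rnorm (z j) ^+ 2.
Proof.
elim: N z => [|N IH] z.
  by rewrite big_seq1 /rademacher !big_ord0 rnorm0 expr0n mulr0.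
rewrite big_signsS big_ord_recl.
under eq_bigr do
  rewrite !rademacherS [- _ + _]addrC [z 0%N + _]addrC parallelogram.
rewrite -mulr_sumr big_split/= IH big_const_seq count_predT size_signs.
rewrite iter_addr_0 -[_ *+ (2 ^ N)]mulr_natl natrX [2 ^+ N.+1]exprS.
by rewrite -[RHS]mulrA -mulrDr [in RHS]addrC.
Qed.

Lemma rademacher_moment4 N (z : nat -> K^o) :
  \sum_(w <- signs N) rnorm (rademacher N z w) ^+ 4 <=
  2 ^+ N * (3 * (\sum_(j < N) rnorm (z j) ^+ 2) ^+ 2).
Proof.
elim: N z => [|N IH] z.
  by rewrite big_seq1 /rademacher !big_ord0 rnorm0 !expr0n !mulr0.
rewrite big_signsS big_ord_recl.
under eq_bigr do rewrite !rademacherS [- _ + _]addrC [z 0%N + _]addrC.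
apply: le_trans (ler_sum _ (fun w _ => rnorm4_le _ _)) _.
rewrite -mulr_sumr !big_split/= -mulr_sumr -mulr_suml rademacher_moment2.
rewrite big_const_seq count_predT size_signs iter_addr_0.
rewrite -[_ *+ (2 ^ N)]mulr_natl natrX.
have := IH (z \o S); have : 0 < (2 : R) ^+ N by rewrite exprn_gt0.
rewrite [2 ^+ N.+1]exprS -[rnorm (z 0%N) ^+ 4]/(_ ^+ (2 * 2)) exprM /=.
have := sqr_ge0 (rnorm (z 0%N) ^+ 2).
set P := 2 ^+ N; set S2 := \sum_(i < N) _; set S4 := \sum_(w <- _) _.
set a := rnorm (z 0%N) ^+ 2 => a0 P0 H.
rewrite -[2 * P * _]mulrA ler_pM2l//.
have -> : P * (3 * (a + S2) ^+ 2) =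
    P * (3 * S2 ^+ 2) + P * (6 * (a * S2)) + P * (3 * a ^+ 2) by ring.
have : P * a ^+ 2 <= P * (3 * a ^+ 2) by rewrite ler_pM2l//; lra.
have -> : 6 * (P * S2 * a) = P * (6 * (a * S2)) by ring.
by lra.
Qed.

Lemma jensen_signs N (f : seq bool -> K^o) :
  rnorm (\sum_(w <- signs N) f w) ^+ 2 <=
  2 ^+ N * \sum_(w <- signs N) rnorm (f w) ^+ 2.
Proof.
elim: N f => [|N IH] f; first by rewrite !big_seq1 mul1r.
rewrite !big_signsS; apply: le_trans (IH _) _.
rewrite exprSr -mulrA ler_pM2l ?exprn_gt0// mulr_sumr; apply: ler_sum => w _.
by rewrite -parallelogram lerDl sqr_ge0.
Qed.

(** Bessel's inequality for the orthonormal Rademacher functions, in a form that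
    serves both scalar fields: on splitting according to the first sign, the
    parallelogram law separates the part of [f] that is odd in it, which gives
    the first coefficient, from the even part, which gives the others. *)
Lemma bessel_signs N (f : seq bool -> K^o) :
  \sum_(j < N)
    rnorm (\sum_(w <- signs N) of_real (sign_at w j) *: f w : K^o) ^+ 2 <=
  2 ^+ N * \sum_(w <- signs N) rnorm (f w) ^+ 2.
Proof.
elim: N f => [|N IH] f; first by rewrite big_ord0 big_seq1 mul1r sqr_ge0.
rewrite big_ord_recl.
have -> : \sum_(w <- signs N.+1) of_real (sign_at w (ord0 : 'I_N.+1)) *: f w =
          \sum_(w <- signs N) (f (false :: w) - f (true :: w)) :> K^o.
  rewrite big_signsS; apply: eq_bigr => w _.
  by rewrite /sign_at/= expr0 expr1 rmorphN1 rmorph1 scaleN1r scale1r.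
have E (j : 'I_N) :
    \sum_(w <- signs N.+1) of_real (sign_at w (lift ord0 j)) *: f w =
    \sum_(w <- signs N)
      of_real (sign_at w j) *: (f (false :: w) + f (true :: w)) :> K^o.
  by rewrite big_signsS; apply: eq_bigr => w _; rewrite scalerDr.
rewrite (eq_bigr _ (fun j _ => congr1 (fun z : K^o => rnorm z ^+ 2) (E j))).
have := IH (fun w => f (false :: w) + f (true :: w)).
have := jensen_signs N (fun w => f (false :: w) - f (true :: w)).
rewrite big_signsS.
have -> : 2 ^+ N.+1 * \sum_(w <- signs N)
     (rnorm (f (false :: w)) ^+ 2 + rnorm (f (true :: w)) ^+ 2) =
   2 ^+ N * \sum_(w <- signs N) rnorm (f (false :: w) + f (true :: w)) ^+ 2 +
   2 ^+ N * \sum_(w <- signs N) rnorm (f (false :: w) - f (true :: w)) ^+ 2.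
  rewrite -mulrDr -big_split exprSr -mulrA mulr_sumr; congr (_ * _).
  by apply: eq_bigr => w _ /=; rewrite parallelogram.
by lra.
Qed.

Definition trunc (z : K^o) : K^o :=
  if rnorm z <= 2 then z else of_real (2 / rnorm z) * z.

Lemma rnorm_trunc z : rnorm (trunc z) <= Num.min 2 (rnorm z).
Proof.
rewrite /trunc le_min; case: (leP (rnorm z) 2) => z2; first by rewrite z2 lexx.
have z0 : 0 < rnorm z by lra.
rewrite rnormM rnorm_of_real ger0_norm ?divr_ge0 ?rnorm_ge0//.
by rewrite divfK ?gt_eqF// lexx ltW.
Qed.

(** The excess of [r] over 2 is at most [r^2 / 8], because [(r - 4)^2 >= 0]; a
    fourth moment thus bounds the second moment of the truncation error. *)
Lemma rnorm_trunc_err z : rnorm (z - trunc z) <= rnorm z ^+ 2 / 8.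
Proof.
rewrite /trunc; case: (leP (rnorm z) 2) => z2.
  by rewrite subrr rnorm0 divr_ge0 ?sqr_ge0.
have z0 : 0 < rnorm z by lra.
have -> : z - of_real (2 / rnorm z) * z = of_real (1 - 2 / rnorm z) * z.
  by rewrite rmorphB/= rmorph1 mulrBl mul1r.
rewrite rnormM rnorm_of_real ger0_norm; last first.
  by rewrite subr_ge0 ler_pdivrMr// mul1r ltW.
rewrite mulrBl mul1r divfK ?gt_eqF//.
by have := sqr_ge0 (rnorm z - 4); rewrite sqrrB; lra.
Qed.

Context {d : nat}.

Definition trunc_row (v : 'rV[K]_d) : 'rV[K]_d := \row_t trunc (v 0 t).

Lemma rnorm_trunc_row v : rnorm (trunc_row v) <= 2.
Proof.
apply: rnorm_row_le => // t; rewrite mxE.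
by have := rnorm_trunc (v 0 t); rewrite le_min => /andP[].
Qed.

Lemma rademacher_coord N (x : nat -> 'rV[K]_d) w t :
  rademacher N x w 0 t = rademacher N (fun j => x j 0 t : K^o) w.
Proof. by rewrite summxE; apply: eq_bigr => j _; rewrite mxE. Qed.

Lemma trunc_rademacher_moment2 N x t : l2_family N x 1 ->
  \sum_(w <- signs N) rnorm (trunc_row (rademacher N x w) 0 t : K^o) ^+ 2
  <= 2 ^+ N.
Proof.
move=> x1.
apply: le_trans (_ : 2 ^+ N * \sum_(j < N) rnorm (x j 0 t : K^o) ^+ 2 <= _).
  rewrite -(rademacher_moment2 N (fun j => x j 0 t : K^o)).
  apply: ler_sum => w _.
  rewrite mxE rademacher_coord lerXn2r ?nnegrE ?rnorm_ge0//.
  set z := rademacher _ _ _.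
  by have := rnorm_trunc z; rewrite le_min => /andP[].
by rewrite -[leRHS]mulr1 ler_pM2l ?exprn_gt0.
Qed.

(** The second moment of the error is at most [3 / 64], which is below
    [(1 / 4)^2]: a gain of a factor 4 in the [l2] norm. *)
Lemma trunc_rademacher_err N x t : l2_family N x 1 ->
  \sum_(w <- signs N)
    rnorm ((rademacher N x w - trunc_row (rademacher N x w)) 0 t : K^o) ^+ 2
  <= 2 ^+ N / 16.
Proof.
move=> x1.
apply: le_trans (_ : 64^-1 * \sum_(w <- signs N)
    rnorm (rademacher N (fun j => x j 0 t : K^o) w) ^+ 4 <= _).
  rewrite mulr_sumr; apply: ler_sum => w _.
  rewrite !mxE rademacher_coord; set z := rademacher _ _ _.
  have : rnorm (z - trunc z) ^+ 2 <= (rnorm z ^+ 2 / 8) ^+ 2.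
    rewrite lerXn2r ?nnegrE ?rnorm_ge0 ?divr_ge0 ?sqr_ge0//.
    exact: rnorm_trunc_err.
  by rewrite exprMn -exprM; lra.
have := rademacher_moment4 N (fun j => x j 0 t : K^o).
have := x1 t; set s := \sum_(j < N) _ => s1.
have s0 : 0 <= s by apply: sumr_ge0 => j _; exact: sqr_ge0.
have s2 : s ^+ 2 <= 1 by rewrite expr_le1.
have P0 : 0 < (2 : R) ^+ N by rewrite exprn_gt0.
have : 2 ^+ N * (3 * s ^+ 2) <= 2 ^+ N * 3 by rewrite ler_pM2l//; lra.
by lra.
Qed.

(** By Bessel's inequality the Rademacher coefficients of the truncation error
    inherit its smallness. *)
Lemma truncated_coef_l2 N (x : nat -> 'rV[K]_d) : l2_family N x 1 ->
  l2_family N (fun j => of_real 4 *: (of_real (2 ^- N) *: \sum_(w <- signs N)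
    of_real (sign_at w j) *:
      (rademacher N x w - trunc_row (rademacher N x w)))) 1.
Proof.
move=> x1 t; have P0 : 0 < (2 : R) ^+ N by rewrite exprn_gt0.
have B := bessel_signs N (fun w =>
  (rademacher N x w - trunc_row (rademacher N x w)) 0 t : K^o).
have H := trunc_rademacher_err t x1.
apply: le_trans (_ : (4 * 2 ^- N) ^+ 2 * (2 ^+ N * (2 ^+ N / 16)) <= 1);
    last first.
  rewrite le_eqVlt; apply/orP; left; apply/eqP.
  by field; rewrite gt_eqF.
apply: le_trans (ler_wpM2l (sqr_ge0 _) (ler_wpM2l (ltW P0) H)).
apply: le_trans (ler_wpM2l (sqr_ge0 _) B).
rewrite mulr_sumr; apply: ler_sum => j _.
rewrite scalerA -rmorphM/= mxE [_ * _]/(_ *: (_ : K^o)) rnormZr exprMn.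
rewrite real_normK ?num_real// summxE.
rewrite le_eqVlt; apply/orP; left; apply/eqP; congr (_ * rnorm _ ^+ 2).
by apply: eq_bigr => w _; rewrite mxE.
Qed.

End Rademacher.

(** * Grothendieck's inequality for multilinear forms *)

Section Slots.
Context {R : realType} {k : scalars}.
Local Notation K := (scalar_field R k).
Context {n : nat} {E : 'I_n -> normedModType K} {F : normedModType K}.
Variable T : (forall i, E i) -> F.
Hypothesis Tml : multilinear_map T.
Implicit Types x : forall i, E i.

Lemma dfwith_id x i : dfwith x i (x i) = x.
Proof. by apply: functional_extensionality_dep => j; case: dfwithP. Qed.

Lemma slot_linear x i : linear (fun v => T (dfwith x i v)).
Proof. by move=> a u v; exact: Tml. Qed.

Definition slot x i : {linear E i -> F} :=
  HB.pack (fun v => T (dfwith x i v))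
    (GRing.isLinear.Build K (E i) F _ _ (@slot_linear x i)).

Lemma slotE x i v : T (dfwith x i v) = slot x i v.
Proof. by []. Qed.

Lemma slotZ x i a v : T (dfwith x i (a *: v)) = a *: T (dfwith x i v).
Proof. by rewrite !slotE linearZ. Qed.

Lemma slot_id x i : slot x i (x i) = T x.
Proof. by rewrite -slotE dfwith_id. Qed.

End Slots.

Section Grothendieck.
Context {R : realType} {k : scalars}.
Local Notation K := (scalar_field R k).
Context {n : nat} {d : 'I_n -> nat}.
Local Notation vecs := (forall i, 'rV[K]_(d i)).
Variable T : vecs -> K^o.
Hypothesis Tml : multilinear_map (E := fun i => 'rV[K]_(d i)) T.
Hypothesis Tle : forall x : vecs, rnorm (T x) <= \prod_i rnorm (x i).
Local Notation slot := (slot (E := fun i => 'rV[K]_(d i)) Tml).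

(** Induction on the arity is done inside a fixed space of [n]-tuples: the
    variables in [A] run over [l2] families, the others are frozen at a vector
    of the unit ball. *)
Definition admissible (A : {set 'I_n}) N (x : nat -> vecs) :=
  (forall i, i \in A -> l2_family N (fun j => x j i) 1) /\
  (forall i, i \notin A -> (forall j, x j i = x 0%N i) /\ rnorm (x 0%N i) <= 1).

Definition summing_bound (A : {set 'I_n}) (C : R) :=
  forall N x, admissible A N x -> rnorm (\sum_(j < N) T (x j)) <= C.

Lemma l2_family_le1 m N (x : nat -> 'rV[K]_m) j : (j < N)%N ->
  l2_family N x 1 -> rnorm (x j) <= 1.
Proof.
move=> jN x1; apply: rnorm_row_le => // t.
rewrite -(@expr_le1 _ 2) ?rnorm_ge0//; apply: le_trans (x1 t).
rewrite (bigD1 (Ordinal jN))//= lerDl; apply: sumr_ge0 => i _.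
exact: sqr_ge0.
Qed.

Lemma l2_family_sum_sq m N (x : nat -> 'rV[K]_m) :
  l2_family N x 1 -> \sum_(j < N) rnorm (x j) ^+ 2 <= m%:R.
Proof.
move=> x1.
apply: le_trans (_ :
    \sum_(t < m) (\sum_(j < N) rnorm (x j 0 t : K^o) ^+ 2) <= _).
  rewrite exchange_big/=; apply: ler_sum => j _.
  have S0 : 0 <= \sum_(i < m) rnorm (x j 0 i : K^o) ^+ 2.
    by apply: sumr_ge0 => i _; exact: sqr_ge0.
  rewrite -[leRHS]sqr_sqrtr// lerXn2r ?nnegrE ?rnorm_ge0 ?sqrtr_ge0//.
  apply: rnorm_row_le => [|t]; first exact: sqrtr_ge0.
  rewrite -[leLHS]ger0_norm ?rnorm_ge0// -sqrtr_sqr ler_wsqrtr//.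
  rewrite (bigD1 t)//= lerDl.
  by apply: sumr_ge0 => i _; exact: sqr_ge0.
apply: le_trans (ler_sum _ (fun t _ => x1 t)) _.
by rewrite big_const_ord iter_addr_0.
Qed.

(** A bound that depends on the dimensions, but not on the length of the
    families; it only serves to make the best constant finite, so that the
    self-improving inequalities below can be solved for it. *)
Lemma summing_bound_exists (A : {set 'I_n}) a b :
  a \in A -> b \in A -> a != b -> exists C, summing_bound A C.
Proof.
move=> aA bA ab; exists ((d a)%:R + (d b)%:R) => N x [xA xC].
apply: le_trans (rnorm_sum _ _ _) _.
apply: le_trans (_ :
    \sum_(j < N) (rnorm (x j a) ^+ 2 + rnorm (x j b) ^+ 2) <= _).
  apply: ler_sum => j _; apply: le_trans (Tle _) _.
  rewrite (bigD1 a)//= (bigD1 b)//=; last by rewrite eq_sym.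
  have P1 : \prod_(i < n | (i != a) && (i != b)) rnorm (x j i) <= 1.
    apply: prodr_ile1 => i _; rewrite rnorm_ge0/=.
    have [iA|/xC[-> //]] := boolP (i \in A).
    exact: l2_family_le1 (ltn_ord j) (xA i iA).
  have := ler_wpM2l (rnorm_ge0 (x j b)) P1; rewrite mulr1 => H.
  have := ler_wpM2l (rnorm_ge0 (x j a)) H.
  move: (rnorm_ge0 (x j a)) (rnorm_ge0 (x j b)).
  by set u := rnorm (x j a); set v := rnorm (x j b); nra.
rewrite big_split/=; apply: lerD.
  exact: (@l2_family_sum_sq _ _ (fun j => x j a) (xA a aA)).
exact: (@l2_family_sum_sq _ _ (fun j => x j b) (xA b bA)).
Qed.

(** Applied to the least bound [S], the hypothesis reads [S <= c + S / 2]. *)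
Lemma summing_bound_absorb A (c : R) : 0 <= c ->
  (exists C, summing_bound A C) ->
  (forall C, summing_bound A C -> summing_bound A (c + C / 2)) ->
  summing_bound A (2 * c).
Proof.
move=> c0 [C0 C0P] step.
pose S := [set r | exists N x,
  admissible A N x /\ r = rnorm (\sum_(j < N) T (x j))].
have S0 : S !=set0.
  exists 0, 0%N, (fun _ _ => 0); split; last by rewrite big_ord0 rnorm0.
  split=> [i _ t|i _]; first by rewrite big_ord0.
  by split=> //; rewrite rnorm0.
have supS : summing_bound A (sup S).
  move=> N x xa; apply: ub_le_sup; last by exists N, x.
  by exists C0 => _ [M [y [ya ->]]]; exact: C0P.
have : sup S <= c + sup S / 2.
  by apply: ge_sup => // _ [M [y [ya ->]]]; exact: step.
move=> H N x xa; apply: le_trans (supS N x xa) _; lra.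
Qed.

(** Each [x_j] in slot [a] is the [j]-th Rademacher coefficient of the
    Rademacher sum of the family. Truncating this sum at height 2 replaces the slot by the
    uniformly bounded vectors [X w], at the price of an error family in the same
    slot which is an [l2] family of constant [1 / 4], hence costs [C / 4]. *)
Lemma slot_split (A : {set 'I_n}) a N x (C : R) :
  a \in A -> summing_bound A C -> admissible A N x ->
  exists X : seq bool -> 'rV[K]_(d a),
    [/\ forall w, rnorm (X w) <= 2,
        forall t, \sum_(w <- signs N) rnorm (X w 0 t : K^o) ^+ 2 <= 2 ^+ N &
        rnorm (\sum_(j < N) T (x j)) <=
          2 ^- N * rnorm (\sum_(w <- signs N)
            \sum_(j < N) of_real (sign_at w j) * slot (x j) a (X w)) + C / 4].
Proof.
move=> aA bC xa; have [xA xC] := xa.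
pose xs j := x j a.
pose X w := trunc_row (rademacher N xs w).
pose Y w := rademacher N xs w - X w.
exists X; split=> [w|t|]; first exact: rnorm_trunc_row.
  exact: trunc_rademacher_moment2 (xA a aA).
pose z j := of_real (2 ^- N) *:
  \sum_(w <- signs N) of_real (sign_at w j) *: Y w.
have xE (j : 'I_N) : x j a = of_real (2 ^- N) *:
    (\sum_(w <- signs N) of_real (sign_at w j) *: X w) + z j.
  rewrite [LHS](rademacher_coef xs (ltn_ord j)) /z -scalerDr -big_split.
  congr (_ *: _); apply: eq_bigr => w _ /=.
  by rewrite -scalerDr /Y addrC subrK.
have Tx (j : 'I_N) : T (x j) = of_real (2 ^- N) *
    (\sum_(w <- signs N) of_real (sign_at w j) * slot (x j) a (X w)) +
    of_real 4^-1 * T (dfwith (x j) a (of_real 4 *: z j)).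
  rewrite -(slot_id Tml (x j) a) [in LHS]xE linearD linearZ linear_sum.
  congr (_ * _ + _); first by apply: eq_bigr => w _; rewrite linearZ.
  have -> : T (dfwith (x j) a (of_real 4 *: z j)) =
      of_real 4 * slot (x j) a (z j).
    exact: (slotZ Tml).
  by rewrite mulrA -rmorphM/= mulVf// rmorph1 mul1r.
rewrite (eq_bigr _ (fun j _ => Tx j)) big_split/= -!mulr_sumr.
apply: le_trans (rnormD _ _) _; rewrite !rnormM !rnorm_of_real.
rewrite !ger0_norm ?invr_ge0 ?exprn_ge0//; apply: lerD.
  rewrite ler_wpM2l ?invr_ge0 ?exprn_ge0//.
  by rewrite exchange_big.
rewrite mulrC ler_wpM2r//.
apply: (bC N (fun j => dfwith (x j) a (of_real 4 *: z j))).
split=> i iA.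
  have [<-|ai] := eqVneq a i.
    move=> t /=.
    under eq_bigr do rewrite dfwithin.
    exact: (truncated_coef_l2 (xA a aA)).
  move=> t /=; under eq_bigr do rewrite dfwithout//.
  exact: xA.
have ai : a != i by apply: contraNneq iA => <-.
rewrite !dfwithout//; have [xi ?] := xC i iA; split=> // j.
by rewrite dfwithout.
Qed.

(** For each sign pattern the main term freezes slot [a] at the bounded vector
    [X w], halved to lie in the unit ball; the signs are absorbed by the family
    in slot [b]. *)
Lemma summing_bound_step (A : {set 'I_n}) a b (C' C : R) :
  a \in A -> b \in A -> a != b ->
  summing_bound (A :\ a) C' -> summing_bound A C ->
  summing_bound A (2 * C' + C / 2).
Proof.
move=> aA bA ab bC' bC N x xa.
have C0 : 0 <= C by apply: le_trans (bC N x xa); exact: rnorm_ge0.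
have [X [X2 _]] := slot_split aA bC xa; move/le_trans; apply.
have [xA xC] := xa.
apply: lerD; last by lra.
rewrite ler_pdivrMl ?exprn_gt0//; apply: le_trans (rnorm_sum _ _ _) _.
apply: le_trans (_ : \sum_(w <- signs N) 2 * C' <= _); last first.
  rewrite big_const_seq count_predT size_signs iter_addr_0.
  by rewrite -[leLHS]mulr_natl natrX.
apply: ler_sum => w _.
pose y j : vecs := dfwith (dfwith (x j) a (of_real 2^-1 *: X w)) b
  (of_real (sign_at w j) *: x j b).
have yE (j : 'I_N) : of_real (sign_at w j) * slot (x j) a (X w) =
    of_real 2 * T (y j).
  rewrite /y (slotE Tml) linearZ -(dfwithout (x j) (of_real 2^-1 *: X w) ab).
  rewrite slot_id (slotE Tml) linearZ/= /GRing.scale/= !mulrA; congr (_ * _).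
  by rewrite -mulrA mulrC -!mulrA -rmorphM/= mulVf// rmorph1 mulr1.
rewrite (eq_bigr _ (fun j _ => yE j)) -mulr_sumr rnormM rnorm_of_real.
rewrite ger0_norm//.
rewrite ler_pM2l//; apply: bC'; split=> i.
  rewrite !inE => /andP[ia iA].
  have [bi|bi] := eqVneq b i.
    subst i => t; apply: le_trans (xA b iA t); apply: ler_sum => j _.
    by rewrite /y dfwithin mxE rnormM rnorm_of_real norm_sign_at mul1r.
  move=> t; apply: le_trans (xA i iA t); apply: ler_sum => j _.
  by rewrite /y dfwithout// dfwithout// eq_sym.
rewrite !inE negb_and negbK => /orP[/eqP ->|iA].
  have ba : b != a by rewrite eq_sym.
  split=> [j|]; rewrite /y !(dfwithout _ _ ba) !dfwithin//.
  rewrite rnormZr ger0_norm ?invr_ge0//.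
  by have := X2 w; lra.
have ai : a != i by apply: contraNneq iA => <-.
have bi : b != i by apply: contraNneq iA => <-.
have [xi1 xi2] := xC i iA.
split=> [j|]; rewrite /y !(dfwithout _ _ bi) !(dfwithout _ _ ai)//.
Qed.

Lemma signs_family m N (f : seq bool -> 'rV[K]_m) (c : R) :
  (forall t, \sum_(w <- signs N) rnorm (f w 0 t : K^o) ^+ 2 <= c) ->
  l2_family (2 ^ N)%N (fun j => f (nth [::] (signs N) j)) c.
Proof.
by move=> H t; have := H t; rewrite (big_nth [::]) size_signs big_mkord.
Qed.

(** With two active slots, the sum over [j] is carried out in slot [b] and gives
    the Rademacher sum [Y w] there. Truncating it too, the main term is the
    average of values of [T] at vectors of norm at most 2, and the error term is
    the sum of [T] over a family indexed by the sign patterns, which is again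
    admissible up to the factor 4: this is why the bound has to be independent
    of the length of the families. *)
Lemma bilinear_step a b (C : R) : a != b ->
  summing_bound [set a; b]%SET C -> summing_bound [set a; b]%SET (4 + C / 2).
Proof.
move=> ab bC N x xa.
have aA : a \in [set a; b]%SET by rewrite set21.
have bA : b \in [set a; b]%SET by rewrite set22.
have ba : b != a by rewrite eq_sym.
have [X [X2 X1 H]] := slot_split aA bC xa; apply: le_trans H _.
have [xA xC] := xa.
pose xs j := x j b.
pose Y w := rademacher N xs w.
pose P (w : seq bool) : vecs := dfwith (x 0%N) a (X w).
have slotP w : \sum_(j < N) of_real (sign_at w j) * slot (x j) a (X w) =
    slot (P w) b (trunc_row (Y w)) + slot (P w) b (Y w - trunc_row (Y w)).
  rewrite -linearD addrC subrK /Y /rademacher linear_sum.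
  apply: eq_bigr => j _; rewrite linearZ; congr (_ * _).
  congr T; apply: functional_extensionality_dep => i.
  have [<-|bi] := eqVneq b i; first by rewrite dfwithin dfwithout.
  rewrite (dfwithout _ _ bi) /P.
  have [<-|ai] := eqVneq a i; first by rewrite !dfwithin.
  rewrite !dfwithout//.
  by have [->] : (forall j, x j i = x 0%N i) /\ rnorm (x 0%N i) <= 1
    by apply: xC; rewrite !inE negb_or ![i == _]eq_sym ai bi.
(* The weight [2 ^- N] of the average is shared equally by the two slots. *)
pose s : R := Num.sqrt (2 ^- N).
have P0 : 0 < (2 : R) ^+ N by rewrite exprn_gt0.
have s2 : s ^+ 2 = 2 ^- N by rewrite sqr_sqrtr// invr_ge0 ltW.
have s0 : 0 < s by rewrite sqrtr_gt0 invr_gt0.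
have main w : rnorm (slot (P w) b (trunc_row (Y w))) <= 4.
  rewrite -slotE; apply: le_trans (Tle _) _.
  rewrite (bigD1 a)//= (bigD1 b)//= dfwithin (dfwithout _ _ ba) /P dfwithin.
  have Q1 : \prod_(i < n | (i != a) && (i != b))
      rnorm (dfwith (dfwith (x 0%N) a (X w)) b (trunc_row (Y w)) i) <= 1.
    apply: prodr_ile1 => i /andP[ia ib]; rewrite rnorm_ge0/=.
    rewrite !dfwithout; [|by rewrite eq_sym|by rewrite eq_sym].
    by have [] := xC i; rewrite // !inE negb_or ia.
  have := ler_wpM2l (rnorm_ge0 (trunc_row (Y w))) Q1; rewrite mulr1 => H.
  have := ler_wpM2l (rnorm_ge0 (X w)) H => /le_trans; apply.
  have := rnorm_trunc_row (Y w); have := X2 w.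
  by move: (rnorm_ge0 (X w)) (rnorm_ge0 (trunc_row (Y w))); nra.
pose f w : vecs := dfwith (dfwith (x 0%N) a (of_real s *: X w)) b
  (of_real (4 * s) *: (Y w - trunc_row (Y w))).
have fE w : T (f w) = of_real (4 * 2 ^- N) *
    slot (P w) b (Y w - trunc_row (Y w)).
  have -> : T (f w) = of_real s * T (dfwith (P w) b
      (of_real (4 * s) *: (Y w - trunc_row (Y w)))).
    set v := _ *: (Y w - _).
    have sw (u : 'rV[K]_(d a)) : dfwith (dfwith (x 0%N) a u) b v =
        dfwith (dfwith (x 0%N) b v) a u.
      apply: functional_extensionality_dep => i.
      have [<-|bi] := eqVneq b i.
        by rewrite dfwithin dfwithout// dfwithin.
      rewrite (dfwithout _ _ bi).
      have [<-|ai] := eqVneq a i; first by rewrite !dfwithin.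
      by rewrite !dfwithout.
    by rewrite /f /P !sw (slotE Tml) linearZ.
  by rewrite (slotE Tml) linearZ/= mulrA -rmorphM/= -s2 expr2 mulrCA.
have tail : 4 * 2 ^- N * rnorm (\sum_(w <- signs N)
    slot (P w) b (Y w - trunc_row (Y w))) <= C.
  have c0 : 0 <= 4 * (2 : R) ^- N by rewrite mulr_ge0// invr_ge0 ltW.
  rewrite -{1}(ger0_norm c0) -(@rnorm_of_real R k) -rnormM mulr_sumr.
  rewrite (eq_bigr _ (fun w _ => esym (fE w))).
  rewrite (big_nth [::]) big_mkord size_signs.
  apply: (bC _ (fun j => f (nth [::] (signs N) j))); split=> i.
    rewrite !inE => iab; have [ib|ib] := eqVneq b i.
      move: iab; rewrite -{}ib => _.
      pose g w := of_real (4 * s) *: (Y w - trunc_row (Y w)).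
      have -> : (fun j => f (nth [::] (signs N) j) b) =
          (fun j => g (nth [::] (signs N) j)).
        by apply: funext => j; rewrite /f dfwithin.
      apply: signs_family => t; rewrite /g.
      have := trunc_rademacher_err t (xA b bA).
      under [in X in _ -> X]eq_bigr do rewrite mxE rnormM rnorm_of_real exprMn.
      rewrite -mulr_sumr real_normK ?num_real// exprMn s2 => H.
      have c1 : 0 <= 4 ^+ 2 * (2 : R) ^- N.
        by rewrite mulr_ge0// ?exprn_ge0// invr_ge0 ltW.
      apply: le_trans (ler_wpM2l c1 H) _.
      by rewrite le_eqVlt; apply/orP; left; apply/eqP; field; rewrite gt_eqF.
    have -> : i = a.
      by move: iab; rewrite [i == b]eq_sym (negPf ib) orbF => /eqP.
    have -> : (fun j => f (nth [::] (signs N) j) a) = (fun j => of_real s *: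
          X (nth [::] (signs N) j)).
      by apply: funext => j; rewrite /f dfwithout// dfwithin.
    apply: (signs_family (f := fun w => of_real s *: X w)) => t.
    under eq_bigr do rewrite mxE rnormM rnorm_of_real exprMn.
    rewrite -mulr_sumr real_normK ?num_real// s2.
    by rewrite ler_pdivrMl// mulr1.
  rewrite !inE negb_or => /andP[ia ib].
  rewrite /f !dfwithout; [|by rewrite eq_sym|by rewrite eq_sym].
  split=> [j|]; first by rewrite !dfwithout// eq_sym.
  by have [] := xC i; rewrite // !inE negb_or ia.
rewrite (eq_bigr _ (fun w _ => slotP w)) big_split/=.
have := rnormD (\sum_(w <- signs N) slot (P w) b (trunc_row (Y w)))
  (\sum_(w <- signs N) slot (P w) b (Y w - trunc_row (Y w))).
have : rnorm (\sum_(w <- signs N) slot (P w) b (trunc_row (Y w))) <= 2 ^+ N * 4.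
  apply: le_trans (rnorm_sum _ _ _) _.
  apply: le_trans (ler_sum _ (fun w _ => main w)) _.
  rewrite big_const_seq count_predT size_signs iter_addr_0.
  by rewrite -[leLHS]mulr_natl natrX.
move: tail; set A := rnorm _; set B := rnorm _; set D := rnorm _ => tail HB HD.
have : 2 ^- N * D <= 2 ^- N * (2 ^+ N * 4 + A).
  by rewrite ler_wpM2l ?invr_ge0 ?exprn_ge0//; lra.
rewrite mulrDr mulKf ?gt_eqF//; lra.
Qed.

(** The best constant [G_m] for [m + 2] slots satisfies [G_0 <= 4 + G_0 / 2] and
    [G_(m+1) <= 2 G_m + G_(m+1) / 2]. *)
Theorem grothendieck (A : {set 'I_n}) m : #|A| = m.+2 ->
  summing_bound A (8 * 4 ^+ m).
Proof.
elim: m A => [|m IH] A cA.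
  have /cards2P[a [b [ab AE]]] : #|A| == 2%N by rewrite cA.
  rewrite expr0 mulr1 (_ : 8 = 2 * 4); last by ring.
  rewrite AE; apply: summing_bound_absorb => //.
    by apply: summing_bound_exists ab; [exact: set21|exact: set22].
  by move=> C; exact: bilinear_step.
have /card_gt1P[a [b [aA bA ab]]] : (1 < #|A|)%N by rewrite cA.
have cA' : #|A :\ a| = m.+2.
  by move: cA; rewrite (cardsD1 a A) aA add1n => -[].
have -> : 8 * 4 ^+ m.+1 = 2 * (2 * (8 * 4 ^+ m)) :> R by rewrite exprS; ring.
apply: summing_bound_absorb.
- by rewrite !mulr_ge0// exprn_ge0.
- exact: summing_bound_exists ab.
- by move=> C; apply: summing_bound_step ab _ => //; exact: IH.
Qed.

End Grothendieck.

(** * Summability of multilinear forms *)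

Section Assembly.
Context {R : realType} {k : scalars}.
Local Notation K := (scalar_field R k).

Lemma bounded_partial_sums_lp1 (V : normedModType K) (x : nat -> V) (B : R) :
  (forall N, \sum_(j < N) rnorm (x j) <= B) -> lp 1 x.
Proof.
move=> xB; rewrite /lp/=; apply: le_lt_trans (ltry B).
apply: lime_le.
  by apply: is_cvg_nneseries => j _ _; rewrite lee_fin powR_ge0.
apply: nearW => N; rewrite big_mkord sumEFin lee_fin.
apply: le_trans (xB N); apply: ler_sum => j _.
by rewrite powRr1 ?rnorm_ge0.
Qed.

Context {n : nat} {E : 'I_n -> normedModType K}.
Variable T : (forall i, E i) -> K^o.

Lemma bounded_multilinear_rnorm : bounded_multilinear E K^o T ->
  exists2 C : R, 0 <= C & forall x, rnorm (T x) <= C * \prod_i rnorm (x i).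
Proof.
move=> [_ [C CP]]; exists (rnorm (C : K^o)); first exact: rnorm_ge0.
move=> x; rewrite -(@le_of_real R k) rmorphM rmorph_prod/= -!normE.
have PE : \prod_i `|x i| = \prod_i of_real (rnorm (x i)).
  by apply: eq_bigr => i _; rewrite normE.
have CPx : 0 <= C * \prod_i `|x i| by apply: le_trans (CP x); exact: normr_ge0.
apply: le_trans (CP x) _; rewrite -(ger0_norm CPx) normrM PE.
rewrite [X in _ * X <= _]ger0_norm// prodr_ge0// => i _.
by rewrite -(rmorph0 (@of_real R k)) le_of_real rnorm_ge0.
Qed.

Lemma dfwith_map (F : 'I_n -> normedModType K) (u : forall i, F i -> E i)
    (v : forall i, F i) i (w : F i) :
  (fun j => u j (dfwith v i w j)) = dfwith (fun j => u j (v j)) i (u i w).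
Proof.
apply: functional_extensionality_dep => j.
have [<-|ij] := eqVneq i j; first by rewrite !dfwithin.
by rewrite !dfwithout.
Qed.

(** Composed with the factorizing maps and divided by [B], [T] becomes a form of
    norm at most 1 on finite-dimensional sup-norm spaces. The bound of
    [grothendieck] depends neither on their dimensions nor on [N]. *)
Theorem factorable_summing (x : forall i, nat -> E i) : (2 <= n)%N ->
  bounded_multilinear E K^o T -> (forall i, linf_factorable (x i)) ->
  lp 1 (fun j => T (fun i => x i j)).
Proof.
move=> n2 Tbm xfact; have [C C0 TC] := bounded_multilinear_rnorm Tbm.
have Tml := Tbm.1.
have nE : n = (n - 2).+2 by rewrite -addn2 subnK.
have [D DP] := choice xfact.
pose B : R := C * \prod_i `|D i| + 1.
have PD0 : 0 <= \prod_i `|D i| by apply: prodr_ge0.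
have B0 : 0 < B by rewrite ltr_wpDl// mulr_ge0.
apply: (@bounded_partial_sums_lp1 _ _ (B * (8 * 4 ^+ (n - 2)))) => N.
have [d dP] := choice (fun i => DP i N).
pose u i := sval (cid (dP i)); have uP i := svalP (cid (dP i)).
pose y i := sval (cid (uP i)); have yP i := svalP (cid (uP i)).
pose S (v : forall i, 'rV[K]_(d i)) : K^o :=
  of_real B^-1 * T (fun i => u i (v i)).
have Sml : multilinear_map (E := fun i => 'rV[K]_(d i)) S.
  move=> v i a w1 w2; rewrite /S.
  rewrite !(@dfwith_map (fun i => 'rV[K]_(d i)) (fun i => u i)) linearP Tml.
  by rewrite mulrDr; congr (_ + _); exact: mulrCA.
have Sle v : rnorm (S v) <= \prod_i rnorm (v i).
  rewrite rnormM rnorm_of_real ger0_norm ?invr_ge0 ?(ltW B0)// ler_pdivrMl//.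
  apply: le_trans (TC _) _.
  have P0 : 0 <= \prod_i rnorm (v i).
    by apply: prodr_ge0 => i _; exact: rnorm_ge0.
  have : \prod_i rnorm (u i (v i)) <= \prod_i (`|D i| * rnorm (v i)).
    apply: ler_prod => i _; rewrite rnorm_ge0/=.
    have [uD _ _] := yP i; apply: le_trans (uD _) _.
    by rewrite ler_wpM2r ?rnorm_ge0// ler_norm.
  rewrite big_split/= => H; apply: le_trans (ler_wpM2l C0 H) _.
  by rewrite mulrA ler_wpM2r// lerDl.
(* One slot absorbs the phases [th j], so that the sum of the values becomes the
   sum of their norms. *)
have i0 : 'I_n by exists 0%N; rewrite nE.
have [th thP] := choice (fun j => phase (T (fun i => x i j))).
pose v j : forall i, 'rV[K]_(d i) :=
  dfwith (fun i => y i j) i0 (th j *: y i0 j).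
have Sv (j : 'I_N) : S (v j) = of_real (B^-1 * rnorm (T (fun i => x i j))).
  rewrite /v (slotZ Sml) dfwith_id /S.
  have -> : (fun i => u i (y i j)) = (fun i => x i j).
    apply: functional_extensionality_dep => i.
    by have [_ uy _] := yP i; exact: uy.
  by rewrite rmorphM/= -(thP j).2; exact: mulrCA.
have va : admissible [set: 'I_n]%SET N v.
  split=> i; last by rewrite finset.in_setT.
  move=> _; have [_ _ yl] := yP i.
  have [ii|ii] := eqVneq i0 i.
    subst i => t; apply: le_trans (yl t); apply: ler_sum => j _.
    by rewrite /v dfwithin mxE rnormM (thP j).1 mul1r.
  move=> t; apply: le_trans (yl t); apply: ler_sum => j _.
  by rewrite /v dfwithout.
have cT : #|[set: 'I_n]%SET| = (n - 2).+2 by rewrite cardsT card_ord.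
have := grothendieck Sml Sle cT va.
rewrite (eq_bigr _ (fun j _ => Sv j)) -rmorph_sum/= rnorm_of_real -mulr_sumr.
rewrite ger0_norm; last first.
  by rewrite mulr_ge0 ?invr_ge0 ?(ltW B0)// sumr_ge0// => j _; exact: rnorm_ge0.
by rewrite ler_pdivrMl.
Qed.

End Assembly.

Theorem corollary4 (R : realType) (k : scalars) (n s : nat)
    (hn : (2 <= n)%N) (hs : (1 <= s <= n)%N)
    (E : 'I_n -> completeNormedModType (scalar_field R k))
    (hE : forall i : 'I_n, (i < s)%N -> Linfty_space (E i)) :
  bounded_multilinear (fun i => E i) (scalar_field R k)^o =
  abs_summing (fun i => E i) (scalar_field R k)^o 1
    (fun i : 'I_n => if (i < s)%N then 2 else 1).
Proof.
apply/seteqP; split=> [T Tb|T []//]; split=> // x xw.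
apply: (factorable_summing hn Tb) => i; move: (xw i).
have [is_ xi|_ xi] := boolP (i < s)%N; last exact: lpw1_factorable.
exact: Linfty_lpw2_factorable (hE i is_) xi.
Qed.
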